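(* If $f\in L_1\cap L_2$, then $\|f\|_2=\|\mathcal{F}_o f\|_2=\|f\mathcal{F}_o\|_2$.
   Context: $\mathcal{G}_{2n}$ is the real Clifford algebra generated by an orthonormal basis $e_1,\dots,e_n,e'_1,\dots,e'_n$ of $\mathbb{R}^{2n}$, with $v^2=v\cdot v$ for all vectors $v$ (so basis vectors square to $1$ and distinct basis vectors anticommute). The norm is $|A|^2=\sum_I\alpha_I^2$ for $A=\sum_I\alpha_I e_I$ in the standard basis of ordered products of basis vectors. Put $B_i=e_ie'_i$; then $B_i^2=-1$ and $B_iB_j=B_jB_i$. The measure is $dm(x)=(2\pi)^{-n/2}dx$ on $\mathbb{R}^n$, with $dx$ Lebesgue measure; for $p=1,2$, $L_p$ is the space of (classes of) measurable functions $f\colon\mathbb{R}^n\to\mathcal{G}_{2n}$ with $\|f\|_p=\left(\int_{\mathbb{R}^n}|f(x)|^p\,dm(x)\right)^{1/p}<\infty$. With $I(x,y)=\sum_{i=1}^nB_ix_iy_i$ for $x,y\in\mathbb{R}^n$, the left and right Clifford-Fourier transforms are $$(\mathcal{F}_o f)(y)=\int_{\mathbb{R}^n}e^{-I(x,y)}f(x)\,dm(x),\qquad (f\mathcal{F}_o)(y)=\int_{\mathbb{R}^n}f(x)e^{-I(x,y)}\,dm(x).$$ *)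

(* Defs.v *)
From HB Require Import structures.
From mathcomp Require Import all_boot all_order all_algebra.
From mathcomp Require Import all_classical all_reals all_analysis.
From mathcomp Require Import ring.

Set Implicit Arguments.
Unset Strict Implicit.
Unset Printing Implicit Defensive.
Import Order.TTheory GRing.Theory Num.Theory.
Import numFieldNormedType.Exports.

Local Open Scope ring_scope.

Section symmetric_difference.
Context (T : finType).
Implicit Types A B C : {set T}.

Definition symdiff A B : {set T} := (A :\: B) :|: (B :\: A).

Lemma in_symdiff A B x : (x \in symdiff A B) = (x \in A) (+) (x \in B).
Proof. by rewrite !inE; case: (x \in A); case: (x \in B). Qed.

Lemma symdiffA A B C : symdiff A (symdiff B C) = symdiff (symdiff A B) C.
Proof. by apply/setP => x; rewrite !in_symdiff addbA. Qed.

Lemma symdiffC A B : symdiff A B = symdiff B A.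
Proof. by apply/setP => x; rewrite !in_symdiff addbC. Qed.

Lemma symdiff0 A : symdiff A finset.set0 = A.
Proof. by apply/setP => x; rewrite in_symdiff finset.in_set0 addbF. Qed.

Lemma symdiffK A B : symdiff A (symdiff A B) = B.
Proof. by apply/setP => x; rewrite !in_symdiff addKb. Qed.

Lemma symdiff_eq A B C : (symdiff A B == C) = (B == symdiff A C).
Proof. by apply/eqP/eqP => [<-|->]; rewrite symdiffK. Qed.

End symmetric_difference.

(* The real Clifford algebra on m orthonormal vectors that square to 1.  An
   element is the family of its coefficients in the basis (e_S), S ranging over
   the subsets of 'I_m, where e_S is the product of the e_i, i \in S, in
   increasing order (see [bladeE]). *)
Definition clifford (R : realType) (m : nat) : Type := {ffun {set 'I_m} -> R}.

Section clifford_algebra.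
Context (R : realType) (m : nat).
Implicit Types (S T U : {set 'I_m}) (A B C : clifford R m).

HB.instance Definition _ :=
  GRing.Lmodule.copy (clifford R m) {ffun {set 'I_m} -> R^o}.

Definition coef A S : R := (A : {ffun {set 'I_m} -> R}) S.

Definition mkcliff (a : {set 'I_m} -> R) : clifford R m := finfun a.

Definition blade S : clifford R m := mkcliff (fun T => (T == S)%:R).

(* e_S e_T = csign S T e_(S symdiff T): sorting the concatenation of two
   increasing words costs one sign per inversion, and repeated letters cancel
   because e_i^2 = 1. *)
Definition csign S T : R :=
  (-1) ^+ #|[set p : 'I_m * 'I_m | [&& p.1 \in S, p.2 \in T & (p.2 < p.1)%N]]|.

Definition cmul A B : clifford R m :=
  mkcliff (fun U => \sum_S \sum_(T | symdiff S T == U)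
                      csign S T * (coef A S * coef B T)).

Definition cone : clifford R m := blade finset.set0.

Lemma coefE a S : coef (mkcliff a) S = a S.
Proof. by rewrite /coef /mkcliff ffunE. Qed.

Lemma cliffP A B : coef A =1 coef B <-> A = B.
Proof. by split => [/ffunP|->]. Qed.

Lemma coefD A B S : coef (A + B) S = coef A S + coef B S.
Proof. by rewrite /coef ffunE. Qed.

Lemma coefN A S : coef (- A) S = - coef A S.
Proof. by rewrite /coef ffunE. Qed.

Lemma coef0 S : coef 0 S = 0.
Proof. by rewrite /coef ffunE. Qed.

Lemma coefZ (a : R) A S : coef (a *: A) S = a * coef A S.
Proof. by rewrite /coef ffunE. Qed.

Lemma coef_sum I (r : seq I) (P : pred I) (F : I -> clifford R m) S :
  coef (\sum_(i <- r | P i) F i) S = \sum_(i <- r | P i) coef (F i) S.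
Proof.
by elim/big_rec2: _ => [|i x y _ <-]; rewrite ?coef0 ?coefD.
Qed.

Lemma coef_blade S T : coef (blade S) T = (T == S)%:R.
Proof. exact: coefE. Qed.

Lemma coef_cmul A B U : coef (cmul A B) U =
  \sum_S csign S (symdiff S U) * (coef A S * coef B (symdiff S U)).
Proof.
rewrite coefE; apply: eq_bigr => S _.
rewrite (eq_bigl (pred1 (symdiff S U))) ?big_pred1_eq//.
by move=> T; rewrite symdiff_eq.
Qed.

Let csignE S T : csign S T =
  \prod_(p : 'I_m * 'I_m)
    (-1) ^+ [&& p.1 \in S, p.2 \in T & (p.2 < p.1)%N].
Proof.
rewrite /csign -prodr_const [LHS]big_mkcond; apply: eq_bigr => p _.
by rewrite inE; case: ifP.
Qed.

Lemma csignDl S S' T : csign (symdiff S S') T = csign S T * csign S' T.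
Proof.
rewrite !csignE -big_split; apply: eq_bigr => p _ /=.
rewrite in_symdiff -signr_addb; congr (_ ^+ nat_of_bool _).
by case: (_ \in S); case: (_ \in S'); case: (_ \in T); case: (_ < _)%N.
Qed.

Lemma csignDr S T T' : csign S (symdiff T T') = csign S T * csign S T'.
Proof.
rewrite !csignE -big_split; apply: eq_bigr => p _ /=.
rewrite in_symdiff -signr_addb; congr (_ ^+ nat_of_bool _).
by case: (_ \in S); case: (_ \in T); case: (_ \in T'); case: (_ < _)%N.
Qed.

Lemma csign0l T : csign finset.set0 T = 1.
Proof. by rewrite csignE big1// => p _; rewrite finset.in_set0. Qed.

Lemma csign0r S : csign S finset.set0 = 1.
Proof. by rewrite csignE big1// => p _; rewrite finset.in_set0 andbF. Qed.

Lemma cmulA : associative cmul.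
Proof.
move=> A B C; apply/cliffP => U; rewrite !coef_cmul.
under [RHS]eq_bigr do rewrite coef_cmul mulr_suml mulr_sumr.
rewrite [RHS]exchange_big; apply: eq_bigr => S _ /=.
rewrite coef_cmul !mulr_sumr.
rewrite [RHS](reindex_inj (h := symdiff S)) /=; last first.
  exact: can_inj (symdiffK S).
apply: eq_bigr => T _; rewrite !symdiffK -symdiffA.
set V := symdiff S (symdiff T U).
have -> : symdiff T (symdiff S U) = V by rewrite /V !symdiffA (symdiffC T).
have -> : symdiff S U = symdiff T V.
  by rewrite /V symdiffA (symdiffC T S) -symdiffA symdiffK.
rewrite csignDr csignDl.
by ring.
Qed.

Lemma cmul1 : left_id cone cmul.
Proof.
move=> A; apply/cliffP => U; rewrite coef_cmul (bigD1 finset.set0)//= big1.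
  by rewrite csign0l coef_blade eqxx !mul1r addr0 symdiffC symdiff0.
by move=> S S0; rewrite coef_blade (negPf S0) mul0r mulr0.
Qed.

Lemma cmulr1 : right_id cone cmul.
Proof.
move=> A; apply/cliffP => U; rewrite coef_cmul (bigD1 U)//= big1.
  have -> : symdiff U U = finset.set0.
    by rewrite -[X in symdiff U X]symdiff0 symdiffK.
  by rewrite csign0r coef_blade eqxx mulr1 mul1r addr0.
move=> S SU; rewrite coef_blade symdiff_eq symdiff0 eq_sym (negPf SU).
by rewrite !mulr0.
Qed.

Lemma cmulDl : left_distributive cmul +%R.
Proof.
move=> A B C; apply/cliffP => U; rewrite coefD !coef_cmul -big_split.
by apply: eq_bigr => S _ /=; rewrite coefD mulrDl mulrDr.
Qed.

Lemma cmulDr : right_distributive cmul +%R.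
Proof.
move=> A B C; apply/cliffP => U; rewrite coefD !coef_cmul -big_split.
by apply: eq_bigr => S _ /=; rewrite coefD !mulrDr.
Qed.

Lemma cone_neq0 : cone != 0.
Proof.
apply/eqP => /(congr1 (fun A => coef A finset.set0))/eqP.
by rewrite coef_blade coef0 eqxx oner_eq0.
Qed.

HB.instance Definition _ := GRing.Zmodule_isNzRing.Build (clifford R m)
  cmulA cmul1 cmulr1 cmulDl cmulDr cone_neq0.

Lemma coefM A B U : coef (A * B) U =
  \sum_S csign S (symdiff S U) * (coef A S * coef B (symdiff S U)).
Proof. exact: coef_cmul. Qed.

Lemma cliff_scaleAl (a : R) A B : a *: (A * B) = (a *: A) * B.
Proof.
apply/cliffP => U; rewrite coefZ !coefM mulr_sumr.
by apply: eq_bigr => S _; rewrite coefZ; ring.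
Qed.

Lemma cliff_scaleAr (a : R) A B : a *: (A * B) = A * (a *: B).
Proof.
apply/cliffP => U; rewrite coefZ !coefM mulr_sumr.
by apply: eq_bigr => S _; rewrite coefZ; ring.
Qed.

HB.instance Definition _ :=
  GRing.Lmodule_isLalgebra.Build R (clifford R m) cliff_scaleAl.
HB.instance Definition _ :=
  GRing.Lalgebra_isAlgebra.Build R (clifford R m) cliff_scaleAr.

Definition gen (i : 'I_m) : clifford R m := blade [set i].

Lemma bladeM S T : blade S * blade T = csign S T *: blade (symdiff S T).
Proof.
apply/cliffP => U; rewrite coefM coefZ (bigD1 S)//= big1 => [|S' neS].
  rewrite !coef_blade eqxx mul1r addr0 symdiff_eq.
  by case: eqP => [->|_]; rewrite ?symdiffK ?mulr0.
by rewrite coef_blade (negPf neS) mul0r mulr0.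
Qed.

Lemma gen_sqr i : gen i * gen i = 1.
Proof.
rewrite bladeM; have -> : symdiff [set i] [set i] = finset.set0.
  by apply/setP => x; rewrite in_symdiff addbb inE.
rewrite csignE big1 ?scale1r// => -[a b] _ /=; rewrite !inE.
by case: eqP => [->|//]; case: eqP => [->|//]; rewrite ltnn.
Qed.

Let csign1 i j : csign [set i] [set j] = (-1) ^+ (j < i)%N.
Proof.
rewrite csignE (bigD1 (i, j))//= !inE !eqxx big1 => [|[a b]]; last first.
  by rewrite xpair_eqE !inE /=; case: eqP => //= _; case: eqP.
by rewrite mulr1.
Qed.

Lemma gen_anticomm i j : i != j -> gen i * gen j = - (gen j * gen i).
Proof.
move=> ij; rewrite !bladeM symdiffC !csign1 -scaleNr.
by case: ltngtP ij => [||/val_inj->]; rewrite ?eqxx ?opprK.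
Qed.

Lemma bladeE S : blade S = \prod_(i <- enum S) gen i.
Proof.
suff prodE (s : seq 'I_m) : sorted ltn (map val s) ->
    \prod_(i <- s) gen i = blade [set i in s].
  rewrite prodE; first by congr blade; apply/setP => i; rewrite inE mem_enum.
  apply: (subseq_sorted ltn_trans (s2 := map val (enum 'I_m))).
    by apply: map_subseq; rewrite enumT; exact: filter_subseq.
  by rewrite val_enum_ord iota_ltn_sorted.
elim: s => [_|i s IHs] /=.
  by rewrite big_nil; congr blade; apply/setP => j; rewrite !inE.
move=> is_; rewrite big_cons IHs ?(path_sorted is_)//.
move: is_; rewrite path_sortedE; last exact: ltn_trans.
case/andP=> /allP lti _.
have {}lti j : j \in s -> (i < j)%N by move=> js; apply: lti; exact: map_f.
rewrite bladeM [csign _ _](_ : _ = 1) ?scale1r; last first.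
  rewrite csignE big1// => -[a b] _ /=; rewrite !inE.
  case: eqP => [->|//]; case: (boolP (b \in s)) => [/lti ib|//].
  by rewrite ltnNge (ltnW ib).
congr blade; apply/setP => j; rewrite in_symdiff !inE.
by case: eqP => [->|//]; case: (boolP (i \in s)) => // /lti; rewrite ltnn.
Qed.

Definition cnorm A : R := Num.sqrt (\sum_S coef A S ^+ 2).

(* Limits in the finite-dimensional space [clifford R m] are taken
   coefficientwise. *)
Definition cexp A : clifford R m :=
  mkcliff (fun S => limn (series (fun k => coef ((k`!)%:R^-1 *: A ^+ k) S))).

End clifford_algebra.

Local Open Scope classical_set_scope.

Section lebesgue_measure_Rn.
Context (R : realType).
Local Open Scope ereal_scope.

Section lebesgue_step.
Context (n : nat) (mu : {sigma_finite_measure set (n.-tuple R) -> \bar R}).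

Definition tuple_cons (p : measurableTypeR R * n.-tuple R) : n.+1.-tuple R :=
  [tuple of (p.1 : R) :: p.2].

Lemma measurable_tuple_cons : measurable_fun setT tuple_cons.
Proof.
apply: (@measurable_cons _ _ _ R (fun p => p.1) n (fun p => p.2)).
  exact: measurable_fst.
exact: measurable_snd.
Qed.

Definition lebesgue_step : set (n.+1.-tuple R) -> \bar R :=
  pushforward (@lebesgue_measure R \x mu) tuple_cons.

Let mpreimage A : measurable A -> measurable (tuple_cons @^-1` A).
Proof.
by move=> mA; rewrite -[X in measurable X]setTI; exact: measurable_tuple_cons.
Qed.

Let lebesgue_step0 : lebesgue_step classical_sets.set0 = 0.
Proof. by rewrite /lebesgue_step /pushforward preimage_set0 measure0. Qed.

Let lebesgue_step_ge0 A : 0 <= lebesgue_step A.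
Proof. by rewrite /lebesgue_step /pushforward; exact: measure_ge0. Qed.

Let lebesgue_step_sigma_additive : semi_sigma_additive lebesgue_step.
Proof.
move=> F mF tF mUF; rewrite /lebesgue_step /pushforward preimage_bigcup.
apply: measure_semi_sigma_additive.
- by move=> k; exact: mpreimage.
- apply/trivIsetP => /= i j _ _ ij; rewrite -preimage_setI.
  by move/trivIsetP : tF => /(_ _ _ _ _ ij) ->//; rewrite preimage_set0.
- by rewrite -preimage_bigcup; exact: mpreimage.
Qed.

HB.instance Definition _ := isMeasure.Build _ _ _ lebesgue_step
  lebesgue_step0 lebesgue_step_ge0 lebesgue_step_sigma_additive.

Lemma lebesgue_step_setX (A : set R) (B : set (n.-tuple R)) :
  measurable A -> measurable B ->
  lebesgue_step [set x | A (thead x) /\ B [tuple of behead x]] =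
  lebesgue_measure A * mu B.
Proof.
move=> mA mB; rewrite -product_measure1E//; congr (product_measure1 _ _ _).
have beheadE (p : measurableTypeR R * n.-tuple R) :
    [tuple of behead (tuple_cons p)] = p.2 by exact: val_inj.
apply/seteqP; split => -[a b] /=; rewrite beheadE /tuple_cons/= theadE;
  by case.
Qed.

Lemma measurable_setX_tuple (A : set R) (B : set (n.-tuple R)) :
  measurable A -> measurable B ->
  measurable [set x : n.+1.-tuple R | A (thead x) /\ B [tuple of behead x]].
Proof.
move=> mA mB; apply: measurableI.
  by rewrite -[X in measurable X]setTI; exact: (@measurable_tnth _ R n.+1 ord0).
by rewrite -[X in measurable X]setTI; exact: (@measurable_behead _ R n).
Qed.

Let lebesgue_step_sigma_finite : sigma_finite setT lebesgue_step.
Proof.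
have /sigma_finiteP[F [FT ndF Ffin]] := sigma_finiteT (@lebesgue_measure R).
have /sigma_finiteP[G [GT ndG Gfin]] := sigma_finiteT mu.
exists (fun k => [set x | F k (thead x) /\ G k [tuple of behead x]]).
  apply/seteqP; split => // x _.
  have [i _ Fi] : (\bigcup_k F k) (thead x) by rewrite -FT.
  have [j _ Gj] : (\bigcup_k G k) [tuple of behead x] by rewrite -GT.
  exists (maxn i j) => //; split.
    by move: Fi; exact/subsetPset/ndF/leq_maxl.
  by move: Gj; exact/subsetPset/ndG/leq_maxr.
move=> k; have [mF Fk] := Ffin k; have [mG Gk] := Gfin k; split.
  exact: measurable_setX_tuple.
by rewrite lebesgue_step_setX// lte_mul_pinfty// ge0_fin_numE.
Qed.

HB.instance Definition _ := @Measure_isSigmaFinite.Build _ _ _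
  lebesgue_step lebesgue_step_sigma_finite.

End lebesgue_step.

(* Borel-Lebesgue measure: R^0 is a point of mass 1, and R^(n+1) = R x R^n. *)
Fixpoint lebesgue_borel (n : nat) :
    {sigma_finite_measure set (n.-tuple R) -> \bar R} :=
  if n is k.+1 then lebesgue_step (lebesgue_borel k) else \d_[tuple].

Lemma lebesgue_borel_box n (a b : 'I_n -> R) : (forall i, a i <= b i)%R ->
  lebesgue_borel n [set x | forall i, (a i <= tnth x i <= b i)%R] =
  (\prod_(i < n) (b i - a i))%:E.
Proof.
pose box k (u v : 'I_k -> R) :=
  [set x : k.-tuple R | forall i, (u i <= tnth x i <= v i)%R].
have boxS k (u v : 'I_k.+1 -> R) : box k.+1 u v =
    [set x | `[u ord0, v ord0] (thead x) /\
             box k (u \o lift ord0) (v \o lift ord0) [tuple of behead x]].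
  apply/seteqP; split => x /=.
    move=> uv; split; first by rewrite in_itv/=; exact: uv.
    move=> i; have := uv (lift ord0 i).
    by rewrite [in tnth x _](tuple_eta x) tnthS.
  rewrite in_itv/= => -[uv0 uvS] i; case: (unliftP ord0 i) => [j|] ->//.
  by have := uvS j; rewrite [in tnth x _](tuple_eta x) tnthS.
have mbox k u v : measurable (box k u v).
  elim: k u v => [|k IHk] u v.
    by rewrite (_ : box _ _ _ = setT)//; apply/seteqP; split => // x _ [].
  by rewrite boxS; exact: measurable_setX_tuple.
rewrite -/(box n a b); elim: n a b => [|n IHn] a b ab.
  rewrite big_ord0 /= diracE mem_set//.
  by case.
rewrite boxS big_ord_recl EFinM -(IHn (a \o lift ord0) (b \o lift ord0))/=;
  last by move=> i; exact: ab.
rewrite [LHS](@lebesgue_step_setX _ _ `[a ord0, b ord0]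
  (box n (a \o lift ord0) (b \o lift ord0)))//.
congr (_ * _); rewrite lebesgue_measure_itv/= lte_fin; case: ltP => // ba.
by rewrite (@le_anti _ _ (a ord0) (b ord0)) ?subrr// ab.
Qed.

Definition Rn (n : nat) : Type := caratheodory_type (mu_ext (lebesgue_borel n)).
HB.instance Definition _ n := Measurable.on (Rn n).

(* Lebesgue measure on the sigma-algebra of all Lebesgue-measurable sets: the
   Caratheodory completion of [lebesgue_borel]. *)
Definition lebesgue_Rn n : set (Rn n) -> \bar R :=
  @completed_measure_extension _ _ _ (lebesgue_borel n).
HB.instance Definition _ n := Measure.on (@lebesgue_Rn n).

End lebesgue_measure_Rn.

Section clifford_fourier.
Context (R : realType) (n : nat).
Local Notation G2n := (clifford R (n + n)).
Implicit Types (f : Rn R n -> G2n) (x y : Rn R n) (p : \bar R).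

(* The ordered orthonormal basis of R^2n is e_1, ..., e_n, e'_1, ..., e'_n. *)
Definition e_ (i : 'I_n) : G2n := gen R (lshift n i).
Definition e'_ (i : 'I_n) : G2n := gen R (rshift n i).

Definition bivector (i : 'I_n) : G2n := e_ i * e'_ i.

Definition dm : set (Rn R n) -> \bar R :=
  mscale (NngNum (powR_ge0 (2 * pi) (- (n%:R / 2)))) (@lebesgue_Rn R n).
HB.instance Definition _ := Measure.on dm.

(* Elements of L_p are represented by functions, not by classes modulo almost
   everywhere equality; the norm takes the value +oo outside L_p. *)
Definition normp p f : \bar R := Lnorm dm p (fun x => (cnorm (f x))%:E).

(* Borel measurability into the finite-dimensional space [G2n], read off on
   the coefficients. *)
Definition cmeasurable f : Prop :=
  forall S, measurable_fun setT (fun x => coef (f x) S).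

Definition Lp p f : Prop := cmeasurable f /\ (normp p f < +oo)%E.

Definition cintegral f : G2n :=
  mkcliff (fun S => \int[dm]_x coef (f x) S).

Definition phase x y : G2n :=
  \sum_(i < n) (tnth x i * tnth y i) *: bivector i.

Definition fourier_left f y : G2n :=
  cintegral (fun x => cexp (- phase x y) * f x).

Definition fourier_right f y : G2n :=
  cintegral (fun x => f x * cexp (- phase x y)).

End clifford_fourier.

(* Main.v *)
Require Import Defs.
From HB Require Import structures.
From mathcomp Require Import all_boot all_order all_algebra.
From mathcomp Require Import all_classical all_reals all_analysis.
From mathcomp Require Import measurable_realfun ring lra.

Import Defs.
Import Order.TTheory GRing.Theory Num.Theory.
Import numFieldNormedType.Exports.
Local Open Scope ring_scope.
Set Implicit Arguments.
Unset Strict Implicit.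
Unset Printing Implicit Defensive.
Local Open Scope classical_set_scope.

(** The proof of Plancherel's formula has an analytic core on the line and an
    algebraic reduction to it.

    Analytic core.  For a real function [f] in L1 and L2 of the line, let [C] and
    [S] be its cosine and sine transforms.  Writing [C^2 + S^2] as a double
    integral of [f x f x' cos ((x' - x) y)] and integrating against the weight
    [exp (- e |y|)] gives, by Fubini, an average of the autocorrelation
    [t |-> int f x f (t + x) dx] against a Cauchy density of total mass [2 pi] at
    scale [e] ([weighted_spectrumE]).  As [e] tends to [0], the left-hand side
    increases to the integral of [C^2 + S^2], and the right-hand side tends to
    [2 pi int f^2], because translations are continuous in L2
    ([L2_translation_cvg]).  This is [scalar_plancherel].

    Clifford values.  Let [J] be left or right multiplication by a bivector
    [B i].  It permutes the coefficients up to sign, so it is isometric.  The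
    transform [y |-> int (cos (x y) - sin (x y) J) w x dx] of a Clifford-valued
    [w] is [C - J S], and it becomes [C + J S] when [y] changes sign, so the
    parallelogram law reduces its squared norm to that of the coefficients
    ([vector_plancherel]).

    Several variables.  Since the [B i] commute and square to [-1], the
    exponential of the phase is the product of the factors
    [cos (x_i y_i) - sin (x_i y_i) B i] ([cexp_phase]): the product solves the
    differential equation of the exponential.  Multiplication by it is thus an
    iteration of one-variable rotations, and the formula on R^n follows by
    induction on [n], one variable at a time, through Tonelli's theorem
    ([phase_plancherel]).

    Lebesgue-measurable functions are replaced by Borel functions that agree with
    them almost everywhere ([borel_representative]), so that the integrals over
    the completed measure become integrals over the product measure. *)

(** * Integration of real-valued functions *)

Notation L1 mu f := (integrable mu setT (EFin \o f)).

Section real_integrals.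
Context d (T : measurableType d) (R : realType).
Variable mu : {measure set T -> \bar R}.
Implicit Types f g : T -> R.

Lemma L1_measurable f : L1 mu f -> measurable_fun setT f.
Proof. by case/integrableP => /measurable_EFinP. Qed.

Lemma EFin_Rintegral f : L1 mu f ->
  (\int[mu]_x f x)%:E = (\int[mu]_x (f x)%:E)%E.
Proof. by move=> f1; rewrite fineK//; exact: integrable_fin_num. Qed.

Lemma ge0_L1 f : measurable_fun setT f -> (forall x, 0 <= f x) ->
  (\int[mu]_x (f x)%:E < +oo)%E -> L1 mu f.
Proof.
move=> mf f0 foo; apply/integrableP; split; first exact/measurable_EFinP.
by under eq_integral do rewrite gee0_abs ?lee_fin//.
Qed.

Lemma L1_le f g : measurable_fun setT f -> (forall x, `|f x| <= g x) ->
  L1 mu g -> L1 mu f.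
Proof.
move=> mf fg; apply: le_integrable => //; first exact/measurable_EFinP.
by move=> x _ /=; rewrite lee_fin (le_trans (fg x))// ler_norm.
Qed.

Lemma L1D f g : L1 mu f -> L1 mu g -> L1 mu (fun x => f x + g x).
Proof. by move=> f1 g1; exact: (integrableD measurableT f1 g1). Qed.

Lemma L1Z c f : L1 mu f -> L1 mu (fun x => c * f x).
Proof. by move=> f1; exact: (integrableZl measurableT c f1). Qed.

Lemma L1_norm f : L1 mu f -> L1 mu (fun x => `|f x|).
Proof. exact: integrable_norm. Qed.

Lemma L1_sum I (r : seq I) (f : I -> T -> R) :
  (forall i, L1 mu (f i)) -> L1 mu (fun x => \sum_(i <- r) f i x).
Proof.
move=> f1; rewrite (_ : EFin \o _ = (fun x => \sum_(i <- r) (f i x)%:E)%E).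
  by apply: integrable_sum => // i _; exact: f1.
by apply/funext => x /=; rewrite sumEFin.
Qed.

Lemma Rintegral_sum I (r : seq I) (f : I -> T -> R) :
  (forall i, L1 mu (f i)) ->
  \int[mu]_x (\sum_(i <- r) f i x) = \sum_(i <- r) \int[mu]_x f i x.
Proof.
move=> f1; elim: r => [|i r IHr].
  rewrite big_nil /Rintegral; under eq_integral do rewrite big_nil.
  by rewrite integral0.
rewrite big_cons -IHr -RintegralD//; last exact: L1_sum.
by apply: eq_Rintegral => x _; rewrite big_cons.
Qed.

Lemma L1_bounded (k : T -> R) c f : measurable_fun setT k ->
  (forall x, `|k x| <= c) -> L1 mu f -> L1 mu (fun x => k x * f x).
Proof.
move=> mk kc f1; apply: (@L1_le _ (fun x => c * `|f x|)); last exact/L1Z/L1_norm.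
  by apply: measurable_funM => //; exact: L1_measurable.
by move=> x; rewrite normrM ler_wpM2r.
Qed.

(** By [2 |f g| <= f^2 + g^2]. *)
Lemma L1_mul f g : measurable_fun setT f -> measurable_fun setT g ->
  L1 mu (fun x => f x ^+ 2) -> L1 mu (fun x => g x ^+ 2) -> L1 mu (fun x => f x * g x).
Proof.
move=> mf mg f2 g2; apply: L1_le (L1D f2 g2); first exact: measurable_funM.
move=> x; rewrite ler_norml; apply/andP; split.
  have := sqr_ge0 (f x + g x); have := sqr_ge0 (f x); have := sqr_ge0 (g x).
  nra.
have := sqr_ge0 (f x - g x); have := sqr_ge0 (f x); have := sqr_ge0 (g x).
nra.
Qed.

End real_integrals.

Section real_fubini.
Context d1 d2 (T1 : measurableType d1) (T2 : measurableType d2) (R : realType).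
Variable m1 : {sigma_finite_measure set T1 -> \bar R}.
Variable m2 : {sigma_finite_measure set T2 -> \bar R}.

(** The integrals of the positive and of the negative part are measurable
    separately, and so is [fine]. *)
Lemma measurable_Rintegral (f : T1 * T2 -> R) : measurable_fun setT f ->
  measurable_fun setT (fun x => \int[m2]_y f (x, y)).
Proof.
move=> mf.
apply: (measurableT_comp (f := @fine R) (g := fun x => (\int[m2]_y (f (x, y))%:E)%E)) => //.
have mEf : measurable_fun setT (EFin \o f) by exact/measurable_EFinP.
rewrite (_ : (fun _ => _) = (fun x =>
   (\int[m2]_y ((EFin \o f)^\+ (x, y)) - \int[m2]_y ((EFin \o f)^\- (x, y)))%E)).
  apply: emeasurable_funB; apply: measurable_fun_fubini_tonelli_F => //.
    exact: measurable_funepos.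
  exact: measurable_funeneg.
apply/funext => x; rewrite -[LHS]/(\int[m2]_y (EFin \o f) (x, y))%E [LHS]integralE.
under eq_integral do rewrite funepos_comp/=.
by under [X in (_ - X = _)%E]eq_integral do rewrite funeneg_comp/=.
Qed.

Section integrable.
Variable f : T1 * T2 -> R.
Hypothesis f1 : L1 (m1 \x m2)%E f.

Let F x := fubini_F m2 (EFin \o f) x.

Let L1F : m1.-integrable setT (EFin \o (fine \o F)).
Proof.
have iF := integrable_fubini_F f1.
apply: (le_integrable _ _ _ iF) => //.
  by apply/measurable_EFinP; apply: measurableT_comp => //; exact: (measurable_fubini_F f1).
move=> x _ /=; rewrite /F; case: (fubini_F _ _ _) => [r| |] //=.
  by rewrite normr0 leey.
by rewrite normr0 leey.
Qed.

Lemma L1_Rintegral : L1 m1 (fun x => \int[m2]_y f (x, y)).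
Proof. exact: L1F. Qed.

(** Where the inner integral is infinite, [fine] replaces it by [0]; this happens
    on a null set only, so it does not affect the outer integral. *)
Lemma Rintegral_prod : \int[(m1 \x m2)%E]_z f z = \int[m1]_x \int[m2]_y f (x, y).
Proof.
rewrite [LHS]/Rintegral -integral12_prod_meas1//.
congr fine; apply: ae_eq_integral => //.
- exact: (measurable_fubini_F f1).
- exact: (measurable_int m1 L1F).
have := integrable_ae measurableT (integrable_fubini_F f1).
by apply: filterS => x /= + _ => /(_ I) /fineK <-.
Qed.

End integrable.
End real_fubini.

Section real_fubini_swap.
Context d1 d2 (T1 : measurableType d1) (T2 : measurableType d2) (R : realType).
Variable m1 : {sigma_finite_measure set T1 -> \bar R}.
Variable m2 : {sigma_finite_measure set T2 -> \bar R}.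

Lemma L1_prod (f : T1 * T2 -> R) : measurable_fun setT f ->
  (\int[m1]_x \int[m2]_y (`|f (x, y)|)%:E < +oo)%E -> L1 (m1 \x m2)%E f.
Proof. by move=> mf foo; apply/integrable12ltyP => //; exact/measurable_EFinP. Qed.

Lemma L1_swap (f : T1 * T2 -> R) :
  L1 (m1 \x m2)%E f -> L1 (m2 \x m1)%E (fun z => f (z.2, z.1)).
Proof.
move=> f1; have mf := L1_measurable f1.
apply/integrable21ltyP => /=.
  apply/measurable_EFinP; apply: measurableT_comp => //.
  exact: (measurable_fun_pair measurable_snd measurable_fst).
exact: (integrable12ltyP _ _ (measurable_int _ f1)).1.
Qed.

Lemma Rfubini (f : T1 * T2 -> R) : L1 (m1 \x m2)%E f ->
  \int[m1]_x \int[m2]_y f (x, y) = \int[m2]_y \int[m1]_x f (x, y).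
Proof.
move=> f1; rewrite -Rintegral_prod//.
have := Rintegral_prod (L1_swap f1) => /= <-.
by congr fine; rewrite -(integral21_prod_meas1 f1) -(integral12_prod_meas1 (L1_swap f1)).
Qed.

End real_fubini_swap.

Lemma Rdominated_cvg d (T : measurableType d) (R : realType)
    (mu : {measure set T -> \bar R}) (f_ : nat -> T -> R) (f g : T -> R) :
  (forall n, measurable_fun setT (f_ n)) ->
  (forall x, f_ n x @[n --> \oo] --> f x) -> L1 mu g ->
  (forall n x, `|f_ n x| <= g x) ->
  \int[mu]_x f_ n x @[n --> \oo] --> \int[mu]_x f x.
Proof.
move=> mf_ f_f g1 f_g.
have mf : measurable_fun setT f.
  by apply: (measurable_fun_cvg mf_) => x _; exact: f_f.
have f1 : L1 mu f.
  apply: (L1_le mf _ g1) => x.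
  have cf : `|f_ n x| @[n --> \oo] --> `|f x| by apply: cvg_norm; exact: f_f.
  by apply: (cvgr_to_le cf); exact: nearW.
apply: fine_cvg; rewrite EFin_Rintegral//.
apply: (@dominated_cvg _ _ _ mu setT measurableT _ _ (EFin \o g)) => //.
- by move=> n; exact/measurable_EFinP.
- by move=> x _; apply: cvg_EFin; [exact: nearW|exact: f_f].
- by move=> n x _; rewrite lee_fin.
Qed.

(** * Affine changes of variable and the Poisson kernel *)

Section line.
Context {R : realType}.
Local Notation mu := (@lebesgue_measure R).

Section affine.
Variables (a b : R).
Hypothesis a0 : 0 < a.

Let phi (x : measurableTypeR R) : measurableTypeR R := a * x + b.

Let mphi : measurable_fun setT phi.
Proof. by apply: measurable_funD => //; exact: measurable_funM. Qed.

Let ainv_ge0 : 0 <= a^-1. Proof. by rewrite invr_ge0 ltW. Qed.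

(** Lebesgue measure is determined by its values on half-open intervals, which
    an increasing affine map permutes. *)
Lemma lebesgue_measure_affine (A : set R) : measurable A ->
  pushforward mu phi A = mscale (NngNum ainv_ge0) mu A.
Proof.
move=> mA; rewrite /mscale/=.
suff : mu A = (a%:E * pushforward mu phi A)%E.
  by move=> ->; rewrite muleA -EFinM mulVf ?gt_eqF// mul1e.
pose nu : {measure set (measurableTypeR R) -> \bar R} := mscale (NngNum (ltW a0))
  (measure_function_pushforward__canonical__measure_function_Measure mu mphi).
suff E : forall X, ocitv X -> mu X = nu X by exact: (lebesgue_measure_unique E mA).
move=> _ [[c d]] _ <-; rewrite /nu.
rewrite -[RHS]/(a%:E * mu (phi @^-1` `]c, d]))%E.
rewrite (_ : phi @^-1` _ = `](c - b) / a, (d - b) / a]%classic); last first.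
  apply/seteqP; split => x /=; rewrite !in_itv/= /phi ltr_pdivrMr// ler_pdivlMr//;
  by rewrite (mulrC x) ltrBlDr lerBrDr.
rewrite !lebesgue_measure_itv/= !lte_fin ltr_pM2r ?invr_gt0// ltrD2r.
case: ifP => _; last by rewrite mule0.
by rewrite -!EFinD -EFinM; congr EFin; field; rewrite gt_eqF.
Qed.

Lemma ge0_integral_affine (f : R -> \bar R) : measurable_fun setT f ->
  (forall x, 0 <= f x)%E ->
  (\int[mu]_x f (a * x + b)%R = (a^-1)%:E * \int[mu]_x f x)%E.
Proof.
move=> mf f0; rewrite -(ge0_integral_mscale mu measurableT (NngNum ainv_ge0))//.
transitivity (\int[pushforward mu phi]_x f x)%E.
  by rewrite ge0_integral_pushforward//; move=> x _; exact: f0.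
by apply: eq_measure_integral => A mA _; exact: lebesgue_measure_affine.
Qed.

Lemma L1_affine (f : R -> R) : L1 mu f -> L1 mu (fun x => f (a * x + b)).
Proof.
case/integrableP => mf foo; apply/integrableP; split.
  exact: (measurableT_comp (f := EFin \o f) (g := phi)).
rewrite (ge0_integral_affine (f := fun x => `|(f x)%:E|%E)) //.
  by rewrite lte_mul_pinfty// ?lee_fin// ltW.
exact: measurableT_comp.
Qed.

Lemma Rintegral_affine (f : R -> R) : L1 mu f ->
  \int[mu]_x f (a * x + b) = a^-1 * \int[mu]_x f x.
Proof.
move=> f1; rewrite -RintegralZl//; congr fine.
under [RHS]eq_integral do rewrite EFinM.
rewrite integralZl//= integralE [in RHS]integralE muleBr; last 2 first.
- by [].
- by apply: fin_num_adde_defl; rewrite fin_numN; exact: integrable_neg_fin_num.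
have mf : measurable_fun setT (EFin \o f) by exact: measurable_int f1.
rewrite -!ge0_integral_affine//; last 2 first.
- exact: measurable_funeneg.
- exact: measurable_funepos.
by congr (_ - _)%E; apply: eq_integral => x _;
  rewrite ?(funepos_comp (EFin \o f) phi) ?(funeneg_comp (EFin \o f) phi).
Qed.

End affine.

Lemma ge0_integral_reflect (f : R -> \bar R) : measurable_fun setT f ->
  (forall x, 0 <= f x)%E -> (\int[mu]_x f (- x)%R = \int[mu]_x f x)%E.
Proof.
move=> mf f0.
transitivity (\int[pushforward mu (-%R : _ -> measurableTypeR R)]_x f x)%E.
  by rewrite ge0_integral_pushforward//; move=> x _; exact: f0.
by apply: eq_measure_integral => A mA _; exact: lebesgue_measureN.
Qed.

Section poisson.
Variable e : R.
Hypothesis e0 : 0 < e.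

Lemma measurable_poisson_weight : measurable_fun setT (fun y : R => expR (- (e * `|y|))).
Proof.
apply: measurableT_comp => //; apply: measurableT_comp => //.
by apply: measurable_funM => //; exact: measurableT_comp.
Qed.

Let continuous_weight : continuous (fun y : R => expR (- (e * `|y|))).
Proof.
move=> y; apply: continuous_comp; last exact: continuous_expR.
by apply: cvgN; apply: cvgM; [exact: cvg_cst|exact: norm_continuous].
Qed.

Let continuous_cosM t : continuous (fun y : R => cos (t * y)).
Proof.
move=> y; apply: continuous_comp; last exact: continuous_cos.
by apply: cvgM; [exact: cvg_cst|exact: cvg_id].
Qed.

(** A primitive on the half-line of the weight times [1 + cos (t y)]. *)
Let prim (t y : R) : R := expR (- (e * y)) *
  (- e^-1 + (t * sin (t * y) - e * cos (t * y)) / (e ^+ 2 + t ^+ 2)).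

Let is_derive_prim (t y : R) : is_derive y 1 (prim t) (expR (- (e * y)) * (1 + cos (t * y))).
Proof.
rewrite /prim; apply: is_derive_eq.
rewrite /GRing.scale /=.
have : 0 < e ^+ 2 + t ^+ 2 by rewrite ltr_wpDr ?sqr_ge0// exprn_gt0.
move=> /lt0r_neq0 d0; field.
by rewrite d0 lt0r_neq0.
Qed.

Let cvg_prim t : prim t y @[y --> +oo] --> 0.
Proof.
pose c := e^-1 + (`|t| + e) / (e ^+ 2 + t ^+ 2).
have d0 : 0 < e ^+ 2 + t ^+ 2 by rewrite ltr_wpDr ?sqr_ge0// exprn_gt0.
have ec : expR (- (e * y)) * c @[y --> +oo] --> 0.
  rewrite -(mul0r c); apply: cvgMr_tmp.
  apply: (cvg_comp (fun y => e * y) (fun z => expR (- z))); last exact: cvgr_expR.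
  apply: (gt0_cvgMry e0); exact: cvg_id.
apply/cvgr0Pnorm_le => d d_gt0.
move/cvgr0Pnorm_le : ec => /(_ _ d_gt0); apply: filterS => y.
apply: le_trans; rewrite /prim !normrM ler_wpM2l// [leRHS]ger0_norm; last first.
  by rewrite addr_ge0 ?invr_ge0 ?(ltW e0)// divr_ge0 ?(ltW d0)// addr_ge0 ?(ltW e0).
rewrite (le_trans (ler_normD _ _))// /c lerD//.
  by rewrite normrN ger0_norm// invr_ge0 ltW.
rewrite normrM (@ger0_norm _ (e ^+ 2 + t ^+ 2)^-1) ?invr_ge0 ?(ltW d0)//.
rewrite ler_wpM2r ?invr_ge0 ?(ltW d0)//.
rewrite (le_trans (ler_normB _ _))// !normrM lerD//.
  by rewrite ler_piMr// ler_norml sin_geN1 sin_le1.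
by rewrite (gtr0_norm e0) ler_piMr ?(ltW e0)// ler_norml cos_geN1 cos_le1.
Qed.

Let integral0y t :
  (\int[mu]_(y in [set y | (0 <= y)%R])
     (expR (- (e * `|y|)) * (1 + cos (t * y)))%:E = (e^-1 + e / (e ^+ 2 + t ^+ 2))%:E)%E.
Proof.
rewrite -set_itvcy.
under eq_integral => y.
  rewrite inE/= in_itv/= andbT => y0; rewrite (ger0_norm y0).
  over.
rewrite (ge0_continuous_FTC2y _ _ (cvg_prim t)).
- rewrite -EFinD; congr EFin; rewrite /prim !mulr0 oppr0 expR0 sin0 cos0.
  have : 0 < e ^+ 2 + t ^+ 2 by rewrite ltr_wpDr ?sqr_ge0// exprn_gt0.
  move=> /lt0r_neq0 d0; field.
  by rewrite d0 lt0r_neq0.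
- move=> x _; rewrite mulr_ge0 ?expR_ge0//; have := cos_geN1 (t * x); lra.
- apply: continuous_subspaceT => y; apply: cvgM.
    apply: continuous_comp; last exact: continuous_expR.
    by apply: cvgN; apply: cvgM; [exact: cvg_cst|exact: cvg_id].
  by apply: cvgD; [exact: cvg_cst|exact: continuous_cosM].
- by move=> y _; have [] := is_derive_prim t y.
- apply: cvg_at_right_filter; apply/differentiable_continuous/derivable1_diffP.
  by have [] := is_derive_prim t 0.
- by move=> y _; rewrite derive1E; have [] := is_derive_prim t y.
Qed.

Let integralT t : (\int[mu]_y (expR (- (e * `|y|)) * (1 + cos (t * y)))%:E =
  (2 * (e^-1 + e / (e ^+ 2 + t ^+ 2)))%:E)%E.
Proof.
rewrite ge0_symfun_integralT ?integral0y//.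
- move=> y; apply: cvgM; first exact: continuous_weight.
  by apply: cvgD; [exact: cvg_cst|exact: continuous_cosM].
- by move=> y /=; rewrite normrN mulrN cosN.
Qed.

Let L1_weight_cos t : L1 mu (fun y => expR (- (e * `|y|)) * (1 + cos (t * y))).
Proof.
apply: ge0_L1.
- apply: measurable_funM; first exact: measurable_poisson_weight.
  apply: measurable_funD => //; apply: continuous_measurable_fun.
  exact: continuous_cosM.
- move=> y; rewrite mulr_ge0 ?expR_ge0//; have := cos_geN1 (t * y); lra.
- by rewrite integralT ltry.
Qed.

Lemma L1_poisson_weight : L1 mu (fun y => expR (- (e * `|y|))).
Proof.
have := L1Z (2^-1) (L1_weight_cos 0); apply: eq_integrable => // y _ /=; congr EFin.
by rewrite mul0r cos0; field.
Qed.

(** Adding [1] to the cosine makes the integrand nonnegative, so that a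
    primitive with a limit at infinity gives the integral over the half-line;
    the integral of the weight alone is then subtracted. *)
Lemma cos_transform_poisson t :
  \int[mu]_y (expR (- (e * `|y|)) * cos (t * y)) = 2 * e / (e ^+ 2 + t ^+ 2).
Proof.
have E t' : \int[mu]_y (expR (- (e * `|y|)) * (1 + cos (t' * y))) =
    2 * (e^-1 + e / (e ^+ 2 + t' ^+ 2)) by rewrite /Rintegral integralT.
have := E 0.
under eq_Rintegral do rewrite mul0r cos0 mulrC.
rewrite RintegralZl//; last exact: L1_poisson_weight.
move=> E0.
transitivity (\int[mu]_y (expR (- (e * `|y|)) * (1 + cos (t * y)) - expR (- (e * `|y|)))).
  by apply: eq_Rintegral => y _; ring.
rewrite (RintegralB measurableT (L1_weight_cos t) L1_poisson_weight).
rewrite E (_ : \int[mu]_y expR (- (e * `|y|)) = 2 * e^-1); last first.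
  apply: (@mulfI _ (1 + 1)); first by rewrite lt0r_neq0.
  by rewrite E0; field; rewrite lt0r_neq0.
by field; rewrite !lt0r_neq0// ltr_wpDr ?sqr_ge0// exprn_gt0.
Qed.

End poisson.

(** Twice the derivative of the arctangent: the cosine transform of the weight
    [exp (- |y|)]. *)
Definition cauchy_kernel (s : R) := 2 / (1 + s ^+ 2).

Lemma cauchy_kernel_ge0 s : 0 <= cauchy_kernel s.
Proof. by rewrite /cauchy_kernel divr_ge0// addr_ge0// sqr_ge0. Qed.

Lemma cauchy_kernel_le2 s : cauchy_kernel s <= 2.
Proof.
rewrite /cauchy_kernel ler_pdivrMr ?ltr_pwDl ?sqr_ge0//.
by rewrite ler_peMr// lerDl sqr_ge0.
Qed.

Let continuous_cauchy_kernel : continuous cauchy_kernel.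
Proof. by move=> s; apply: cvgM; [exact: cvg_cst|exact: continuous_oneDsqrV]. Qed.

Lemma measurable_cauchy_kernel : measurable_fun setT cauchy_kernel.
Proof. exact: continuous_measurable_fun. Qed.

Lemma integral_cauchy_kernel :
  (\int[mu]_s (cauchy_kernel s)%:E = (2 * pi)%:E)%E.
Proof.
rewrite ge0_symfun_integralT.
- rewrite -set_itvcy; under eq_integral do rewrite EFinM.
  rewrite ge0_integralZl//.
  + by rewrite integral0y_oneDsqr -!EFinM; congr EFin; field.
  + apply/measurable_EFinP; apply: measurable_funTS; apply: continuous_measurable_fun.
    exact: continuous_oneDsqrV.
  + by move=> s _; rewrite lee_fin invr_ge0 addr_ge0// sqr_ge0.
- exact: cauchy_kernel_ge0.
- exact: continuous_cauchy_kernel.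
- by move=> s /=; rewrite /cauchy_kernel sqrrN.
Qed.

Lemma L1_cauchy_kernel : L1 mu cauchy_kernel.
Proof.
apply: ge0_L1; [exact: measurable_cauchy_kernel|exact: cauchy_kernel_ge0|].
by rewrite integral_cauchy_kernel ltry.
Qed.

End line.

(** * Translations in L2 of the line *)

Section translation.
Context {R : realType}.
Local Notation mu := (@lebesgue_measure R).

Lemma sqr_normr_le (x y : R) : `|x| <= y -> x ^+ 2 <= y ^+ 2.
Proof. by move=> xy; rewrite -(real_normK (num_real x)) lerXn2r// nnegrE (le_trans _ xy). Qed.

Definition tent (N x : R) : R := Num.max 0 (Num.min 1 (N - `|x|)).

Lemma tent_ge0 N x : 0 <= tent N x.
Proof. by rewrite /tent le_max lexx. Qed.

Lemma tent_le1 N x : tent N x <= 1.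
Proof. by rewrite /tent ge_max ler01 ge_min lexx. Qed.

Lemma tent_out N x : N <= `|x| -> tent N x = 0.
Proof.
move=> Nx; apply/max_idPl; rewrite ge_min; apply/orP; right.
by rewrite subr_le0.
Qed.

Lemma tent_in N x : `|x| <= N - 1 -> tent N x = 1.
Proof.
move=> xN; rewrite /tent (_ : Num.min _ _ = 1); first by apply/max_idPr.
by apply/min_idPl; lra.
Qed.

Lemma continuous_tent N : continuous (tent N).
Proof.
move=> x; apply: (@continuous_max R _ (cst 0) (fun x => Num.min 1 (N - `|x|))).
  exact: cvg_cst.
apply: (@continuous_min R _ (cst 1) (fun x => N - `|x|)); first exact: cvg_cst.
by apply: cvgB; [exact: cvg_cst|exact: norm_continuous].
Qed.

Definition clamp (N x : R) : R := Num.max (- N) (Num.min N x).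

Lemma clamp_norm N x : 0 <= N -> `|clamp N x| <= N.
Proof.
move=> N0; rewrite /clamp ler_norml le_max lexx/= ge_max ge_min lexx andbT.
by lra.
Qed.

Lemma clamp_dist N x y : `|x| <= N -> `|x - clamp N y| <= `|x - y|.
Proof.
rewrite ler_norml => /andP[Nx xN]; rewrite /clamp.
have [yN|Ny] := leP y N.
  have [|] := leP (- N) y => // yN'.
  by rewrite !ger0_norm; lra.
have -> : Num.max (- N) N = N by apply/max_idPr; lra.
by rewrite !ler0_norm; lra.
Qed.

Lemma continuous_clamp (g : R -> R) N : continuous g -> continuous (clamp N \o g).
Proof.
move=> cg x; apply: (@continuous_max R _ (cst (- N)) (fun x => Num.min N (g x))).
  exact: cvg_cst.
by apply: (@continuous_min R _ (cst N) g); [exact: cvg_cst|exact: cg].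
Qed.

Lemma continuous_clamp_tent (g : R -> R) N : continuous g ->
  continuous (fun x => clamp N (g x) * tent N x).
Proof.
move=> cg x.
have cc : {for x, continuous (clamp N \o g)} by exact: continuous_clamp.
exact: (cvgM cc (@continuous_tent N x)).
Qed.

Section density.
Variable f : measurableTypeR R -> R.
Hypothesis f1 : L1 mu f.
Hypothesis f2 : L1 mu (fun x => f x ^+ 2).

Let mf : measurable_fun setT f. Proof. exact: L1_measurable f1. Qed.

Let level (N : R) : set (measurableTypeR R) := [set x | `|f x| <= N].

Let mlevel N : measurable (level N).
Proof.
rewrite (_ : level N = f @^-1` `[- N, N]).
  by rewrite -[X in measurable X]setTI; exact: mf.
by apply/seteqP; split => x /=; rewrite /level/= in_itv/= ler_norml.
Qed.

Let trunc N (x : measurableTypeR R) := \1_(level N) x * f x.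

Let mtrunc N : measurable_fun setT (trunc N).
Proof. by apply: measurable_funM => //; exact: measurable_indic. Qed.

Let L1_trunc N : L1 mu (trunc N).
Proof.
apply: (@L1_bounded _ (measurableTypeR R) R mu (\1_(level N)) 1) f1.
  exact: measurable_indic.
by move=> x; rewrite indicE normr_nat; case: (_ \in _).
Qed.

Let trunc_le N x : 0 <= N -> `|trunc N x| <= N.
Proof.
move=> N0; rewrite /trunc indicE; case: (boolP (x \in _)).
  by rewrite inE mul1r.
by rewrite mul0r normr0.
Qed.

Let mtent N : measurable_fun setT (tent N : measurableTypeR R -> R).
Proof. by apply: continuous_measurable_fun; exact: continuous_tent. Qed.

Let cutoff (n : nat) (x : measurableTypeR R) := trunc n.+1%:R x * tent n.+1%:R x.

Let mcutoff n : measurable_fun setT (cutoff n).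
Proof. exact: measurable_funM. Qed.

Let cutoff_dist n x : (f x - cutoff n x) ^+ 2 <= f x ^+ 2.
Proof.
rewrite /cutoff /trunc; set a := \1__ x; set b := tent _ x.
have -> : f x - a * f x * b = (1 - a * b) * f x by ring.
rewrite exprMn ler_piMl ?sqr_ge0//.
have b0 : 0 <= b := tent_ge0 _ _; have b1 : b <= 1 := tent_le1 _ _.
by rewrite /a indicE; case: (_ \in _) => /=; nra.
Qed.

Let cvg_cutoff : \int[mu]_x (f x - cutoff n x) ^+ 2 @[n --> \oo] --> 0.
Proof.
rewrite [X in _ --> X](_ : _ = \int[mu]_x cst 0 x); last first.
  by rewrite Rintegral_cst ?mul0r.
apply: (Rdominated_cvg (g := fun x => f x ^+ 2)) => //.
- move=> n; apply: measurable_funX; exact: measurable_funB.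
- move=> x; apply: (@cvg_near_cst _ _ _ _ _ _); near=> n; apply/eqP.
  rewrite /cutoff /trunc indicE mem_set; last first.
    rewrite /level/=; near: n; exists (Num.truncn `|f x|) => // n /= xn.
    rewrite ltW// (lt_le_trans (truncnS_gt _))// ler_nat ltnS//.
  rewrite mul1r tent_in ?mulr1 ?subrr ?expr0n//.
  rewrite -natr1 addrK; near: n; exists (Num.truncn `|x|).+1 => // n /= xn.
  by rewrite ltW// (lt_le_trans (truncnS_gt _))// ler_nat.
- by move=> n x; rewrite ger0_norm ?sqr_ge0.
Unshelve. all: by end_near. Qed.

Let itv_fin (N : R) : (mu `[(- N)%R, N]%classic < +oo)%E.
Proof. by rewrite lebesgue_measure_itv/=; case: ifP => // _; rewrite -EFinB ltry. Qed.

(** Cut [f] off in height and in width, approximate the result in L1 on an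
    interval, and clamp the approximant: between functions bounded by [N], the
    squared distance is at most [2 N] times the distance. *)
Lemma L2_continuous_approximation (d : R) : 0 < d -> exists2 g : R -> R,
  continuous g & exists2 N : R, 0 <= N &
  [/\ forall x, `|g x| <= N, forall x, N < `|x| -> g x = 0,
    L1 mu (fun x => (f x - g x) ^+ 2) & \int[mu]_x (f x - g x) ^+ 2 <= d].
Proof.
move=> d0.
have /cvgr0Pnorm_le/(_ (d / 4)) := cvg_cutoff.
move=> /(_ _)[|n _ /(_ n (leqnn _))]; first by rewrite divr_gt0.
rewrite /= ger0_norm => [cutoffd|]; last by apply: Rintegral_ge0 => x _; exact: sqr_ge0.
pose N : R := n.+1%:R.
have N0 : 0 < N by [].
have trunc1 : mu.-integrable `[- N, N] (EFin \o trunc N).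
  by apply: integrableS (L1_trunc N).
have [g_ [cg_ g_1 cvg_g]] :=
  approximation_continuous_integrable (measurable_itv _) (itv_fin N) trunc1.
have [_ /cvgr0Pnorm_le/(_ (d / (8 * N)))] := (fine_cvgP _ _).1 cvg_g.
move=> /(_ _)[|k _ /(_ k (leqnn _))/=]; first by rewrite divr_gt0// mulr_gt0.
set I := fine _; move=> Ik.
pose D := (fun x : measurableTypeR R => `|trunc N x - g_ k x|) \_ `[- N, N].
have mE : measurable (`[- N, N]%classic : set (measurableTypeR R)) by [].
have D1 : L1 mu D.
  rewrite /D -restrict_EFin; apply/(integrable_mkcond _ mE).
  by apply: integrable_norm; exact: (integrableB mE trunc1 (g_1 k)).
have DI : \int[mu]_x D x <= d / (8 * N).
  move: Ik; rewrite /D -Rintegral_mkcond /I /Rintegral => /(le_trans _); apply.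
  exact: ler_norm.
have D0 x : 0 <= D x by rewrite /D patchE; case: ifP.
pose g (x : R) := clamp N (g_ k x) * tent N x.
have cg : continuous g.
  exact: continuous_clamp_tent (cg_ k).
have mg : measurable_fun setT (g : measurableTypeR R -> R).
  exact: continuous_measurable_fun cg.
have cutg x : (cutoff n x - g x) ^+ 2 <= 2 * N * D x.
  rewrite /cutoff /g -/N -mulrBl.
  have [xN|Nx] := leP N `|x|.
    by rewrite (tent_out xN) mulr0 expr0n/= mulr_ge0// mulr_ge0// ltW.
  have -> : D x = `|trunc N x - g_ k x|.
    by rewrite /D patchE mem_set//= in_itv/= -ler_norml ltW.
  have := clamp_dist (g_ k x) (trunc_le x (ltW N0)).
  have cN := clamp_norm (g_ k x) (ltW N0); have tN := trunc_le x (ltW N0).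
  move: (trunc N x) (clamp N (g_ k x)) cN tN => a b bN aN abD.
  rewrite exprMn (@le_trans _ _ ((a - b) ^+ 2))//.
    by rewrite ler_piMr ?sqr_ge0// exprn_ile1// ?tent_ge0 ?tent_le1.
  rewrite -(real_normK (num_real (a - b))) expr2 ler_pM//.
  by rewrite (le_trans (ler_normB _ _))// mulr_natl mulr2n lerD.
pose B x := 2 * (f x - cutoff n x) ^+ 2 + 4 * N * D x.
have fgB x : (f x - g x) ^+ 2 <= B x.
  have := cutg x; have := sqr_ge0 ((f x - cutoff n x) - (cutoff n x - g x)).
  by rewrite /B; lra.
have cutoff1 : L1 mu (fun x => (f x - cutoff n x) ^+ 2).
  apply: (@L1_le _ (measurableTypeR R) R mu _ (fun x => f x ^+ 2)) => //.
    by apply: measurable_funX; exact: measurable_funB.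
  by move=> x; rewrite ger0_norm ?sqr_ge0.
have B1 : L1 mu B by apply: L1D; exact: L1Z.
have fg1 : L1 mu (fun x => (f x - g x) ^+ 2).
  apply: L1_le B1; first by apply: measurable_funX; exact: measurable_funB.
  by move=> x; rewrite ger0_norm ?sqr_ge0.
exists g => //; exists N; first exact: ltW.
split=> //.
- move=> x; rewrite /g normrM (le_trans _ (clamp_norm (g_ k x) (ltW N0)))//.
  by rewrite ler_piMr// ger0_norm ?tent_ge0 ?tent_le1.
- by move=> x Nx; rewrite /g tent_out ?mulr0// ltW.
- apply: (le_trans (le_Rintegral measurableT fg1 B1 (fun x _ => fgB x))).
  rewrite RintegralD//; [|exact: L1Z|exact: L1Z].
  rewrite !RintegralZl//.
  have -> : d = 2 * (d / 4) + 4 * N * (d / (8 * N)) by field; rewrite gt_eqF.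
  by rewrite lerD// ler_wpM2l// mulr_ge0// ltW.
Qed.
End density.

Lemma L1_shift (f : measurableTypeR R -> R) b : L1 mu f -> L1 mu (fun x => f (x + b)).
Proof.
move=> f1; have := L1_affine b ltr01 f1; apply: eq_integrable => // x _ /=.
by rewrite mul1r.
Qed.

Lemma Rintegral_shift (f : measurableTypeR R -> R) b : L1 mu f ->
  \int[mu]_x f (x + b) = \int[mu]_x f x.
Proof.
move=> f1; have := Rintegral_affine b ltr01 f1; rewrite invr1 mul1r => <-.
by apply: eq_Rintegral => x _; rewrite mul1r.
Qed.

Lemma measurable_shift (f : measurableTypeR R -> R) (b : R) :
  measurable_fun setT f -> measurable_fun setT (fun x : measurableTypeR R => f (x + b)).
Proof.
move=> mf; apply: (measurableT_comp (f := f) (g := fun x : measurableTypeR R => x + b)) => //.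
exact: measurable_funD.
Qed.

(** For a continuous function of compact support this is dominated convergence;
    [f] is close to such a function [g] in L2, and a translation does not change
    the distance from [f] to [g]. *)
Lemma L2_translation_cvg (f : measurableTypeR R -> R) (t : nat -> R) (B : R) :
  L1 mu f -> L1 mu (fun x => f x ^+ 2) ->
  (forall n, `|t n| <= B) -> t n @[n --> \oo] --> 0 ->
  \int[mu]_x (f (x + t n) - f x) ^+ 2 @[n --> \oo] --> 0.
Proof.
move=> f1 f2 tB t0; have mf := L1_measurable f1.
apply/cvgr0Pnorm_le => e e0.
(* The square of a sum of three terms is at most 3 times the sum of their
   squares; each of these will integrate to at most e / 9. *)
have [|g cg [N N0 [gN gout fg1 fge]]] := L2_continuous_approximation f1 f2 (d := e / 9).
  by rewrite divr_gt0.
have mg : measurable_fun setT (g : measurableTypeR R -> R).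
  exact: continuous_measurable_fun cg.
have gt_bound n x : `|(g (x + t n) - g x) ^+ 2| <=
    (N + N) ^+ 2 * \1_`[- (N + B), N + B]%classic x.
  rewrite ger0_norm ?sqr_ge0// indicE; case: (boolP (x \in _)) => xN.
    by rewrite mulr1; apply: sqr_normr_le; rewrite (le_trans (ler_normB _ _))// lerD.
  have {}xN : N + B < `|x|.
    rewrite ltNge ler_norml; apply: contra xN => xN.
    by rewrite inE/= in_itv.
  have B0 : 0 <= B by rewrite (le_trans _ (tB 0)).
  rewrite !gout; [by rewrite subrr expr0n mulr0| lra |].
  have := ler_normB (x + t n) (t n); rewrite addrK; have := tB n; lra.
have gt1 n : L1 mu (fun x => (g (x + t n) - g x) ^+ 2).
  apply: (@L1_le _ (measurableTypeR R) R mu _ _ _ (gt_bound n)).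
    by apply: measurable_funX; apply: measurable_funB => //; exact: measurable_shift.
  by apply: L1Z; exact: integrable_indic_itv.
have : \int[mu]_x (g (x + t n) - g x) ^+ 2 @[n --> \oo] --> 0.
  rewrite [X in _ --> X](_ : _ = \int[mu]_x cst 0 x); last first.
    by rewrite Rintegral_cst ?mul0r.
  apply: (@Rdominated_cvg _ (measurableTypeR R) R mu _ _
    (fun x => (N + N) ^+ 2 * \1_`[- (N + B), N + B]%classic x)) => //.
  - by move=> n; exact: L1_measurable (gt1 n).
  - move=> x; rewrite [X in _ --> X](_ : _ = (g (x + 0) - g x) ^+ 2); last first.
      by rewrite addr0 subrr expr0n.
    apply: (@cvg_comp _ _ _ _ (fun z => z ^+ 2)); last exact: exprn_continuous.
    apply: cvgB; last exact: cvg_cst.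
    apply: (@cvg_comp _ _ _ (fun n => x + t n) g); last exact: cg.
    by apply: cvgD; [exact: cvg_cst|].
  - by apply: L1Z; exact: integrable_indic_itv.
move/cvgr0Pnorm_le => /(_ (e / 9)) /(_ _)[|k _ ke]; first by rewrite divr_gt0.
exists k => // n /= kn; have := ke n kn; rewrite /=.
rewrite !ger0_norm; last 2 first.
- by apply: Rintegral_ge0 => x _; exact: sqr_ge0.
- by apply: Rintegral_ge0 => x _; exact: sqr_ge0.
move=> ge.
have fgt1 := L1_shift (t n) fg1.
have Efgt := Rintegral_shift (t n) fg1.
pose H x := 3 * ((f (x + t n) - g (x + t n)) ^+ 2 + (g (x + t n) - g x) ^+ 2 +
  (f x - g x) ^+ 2).
have fH x : (f (x + t n) - f x) ^+ 2 <= H x.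
  rewrite /H; move: (f _) (f _) (g _) (g _) => a b c d.
  have := sqr_ge0 ((a - c) - (c - d)); have := sqr_ge0 ((c - d) + (b - d)).
  have := sqr_ge0 ((a - c) + (b - d)); nra.
have H1 : L1 mu H by apply: L1Z; apply: L1D => //; exact: L1D.
have ft1 : L1 mu (fun x => (f (x + t n) - f x) ^+ 2).
  apply: L1_le H1.
    by apply: measurable_funX; apply: measurable_funB => //; exact: measurable_shift.
  by move=> x; rewrite ger0_norm ?sqr_ge0.
apply: (le_trans (le_Rintegral measurableT ft1 H1 (fun x _ => fH x))).
rewrite RintegralZl//; last by apply: L1D => //; exact: L1D.
rewrite RintegralD//; last exact: L1D.
by rewrite RintegralD// Efgt; lra.
Qed.

End translation.

(** * Plancherel's formula for real functions on the line *)

Section tensor.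
Context d1 d2 (T1 : measurableType d1) (T2 : measurableType d2) (R : realType).
Variable m1 : {sigma_finite_measure set T1 -> \bar R}.
Variable m2 : {sigma_finite_measure set T2 -> \bar R}.

Lemma L1_tensor (u : T1 -> R) (v : T2 -> R) : L1 m1 u -> L1 m2 v ->
  L1 (m1 \x m2)%E (fun z => u z.1 * v z.2).
Proof.
move=> u1 v1; have mu_ := L1_measurable u1; have mv := L1_measurable v1.
apply: L1_prod.
  by apply: measurable_funM; exact: measurableT_comp.
have E x : (\int[m2]_y (`|u x * v y|)%:E = (`|u x| * \int[m2]_y `|v y|)%:E)%E.
  under eq_integral do rewrite normrM.
  rewrite -RintegralZl ?EFin_Rintegral//; last exact: L1_norm.
  by apply: L1Z; exact: L1_norm.
under eq_integral do rewrite /= E mulrC.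
rewrite -EFin_Rintegral ?ltry//.
by apply: L1Z; exact: L1_norm.
Qed.

End tensor.

Section scalar_plancherel.
Context {R : realType}.
Local Notation mu := (@lebesgue_measure R).
Local Notation T := (measurableTypeR R).

Definition cos_transform (f : T -> R) (y : T) : R := \int[mu]_x (cos (x * y) * f x).
Definition sin_transform (f : T -> R) (y : T) : R := \int[mu]_x (sin (x * y) * f x).

Lemma measurable_cosM d (U : measurableType d) (a b : U -> R) :
  measurable_fun setT a -> measurable_fun setT b ->
  measurable_fun setT (fun u => cos (a u * b u)).
Proof.
move=> ma mb; apply: measurableT_comp; last exact: measurable_funM.
by apply: continuous_measurable_fun; exact: continuous_cos.
Qed.

Lemma measurable_sinM d (U : measurableType d) (a b : U -> R) :
  measurable_fun setT a -> measurable_fun setT b ->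
  measurable_fun setT (fun u => sin (a u * b u)).
Proof.
move=> ma mb; apply: measurableT_comp; last exact: measurable_funM.
by apply: continuous_measurable_fun; exact: continuous_sin.
Qed.

Lemma norm_cos_le1 (x : R) : `|cos x| <= 1.
Proof. by rewrite ler_norml cos_geN1 cos_le1. Qed.

Lemma norm_sin_le1 (x : R) : `|sin x| <= 1.
Proof. by rewrite ler_norml sin_geN1 sin_le1. Qed.

Section transforms.
Variable f : T -> R.
Hypothesis f1 : L1 mu f.

Let mf : measurable_fun setT f. Proof. exact: L1_measurable f1. Qed.

Lemma L1_cosM y : L1 mu (fun x => cos (x * y) * f x).
Proof.
apply: (L1_bounded (mu := mu) (c := 1)) f1.
  by apply: measurable_cosM.
by move=> x; exact: norm_cos_le1.
Qed.

Lemma L1_sinM y : L1 mu (fun x => sin (x * y) * f x).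
Proof.
apply: (L1_bounded (mu := mu) (c := 1)) f1.
  by apply: measurable_sinM.
by move=> x; exact: norm_sin_le1.
Qed.

Lemma measurable_cos_transform : measurable_fun setT (cos_transform f).
Proof.
apply: (measurable_Rintegral mu (f := fun z : T * T => cos (z.2 * z.1) * f z.2)).
by apply: measurable_funM; [exact: measurable_cosM|exact: measurableT_comp].
Qed.

Lemma measurable_sin_transform : measurable_fun setT (sin_transform f).
Proof.
apply: (measurable_Rintegral mu (f := fun z : T * T => sin (z.2 * z.1) * f z.2)).
by apply: measurable_funM; [exact: measurable_sinM|exact: measurableT_comp].
Qed.

Let M := \int[mu]_x `|f x|.

Let M0 : 0 <= M. Proof. by apply: Rintegral_ge0 => x _. Qed.

Lemma cos_transform_le y : `|cos_transform f y| <= M.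
Proof.
apply: (le_trans (le_normr_Rintegral measurableT (L1_cosM y))).
apply: le_Rintegral => //; [exact/L1_norm/L1_cosM|exact: L1_norm|].
by move=> x _; rewrite normrM ler_piMl// norm_cos_le1.
Qed.

Lemma sin_transform_le y : `|sin_transform f y| <= M.
Proof.
apply: (le_trans (le_normr_Rintegral measurableT (L1_sinM y))).
apply: le_Rintegral => //; [exact/L1_norm/L1_sinM|exact: L1_norm|].
by move=> x _; rewrite normrM ler_piMl// norm_sin_le1.
Qed.

(** The squared modulus of the complex Fourier transform of [f]. *)
Definition power_spectrum y := cos_transform f y ^+ 2 + sin_transform f y ^+ 2.

Lemma measurable_power_spectrum : measurable_fun setT power_spectrum.
Proof.
apply: measurable_funD; apply: measurable_funX.
  exact: measurable_cos_transform.
exact: measurable_sin_transform.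
Qed.

Lemma power_spectrum_ge0 y : 0 <= power_spectrum y.
Proof. by rewrite addr_ge0 ?sqr_ge0. Qed.

Let G (x y : T) := cos (x * y) * cos_transform f y + sin (x * y) * sin_transform f y.

Let GE x y : G x y = \int[mu]_x' (f x' * cos ((x' - x) * y)).
Proof.
rewrite /G /cos_transform /sin_transform -!RintegralZl//; last 2 first.
- exact: L1_sinM.
- exact: L1_cosM.
rewrite -RintegralD//; last 2 first.
- exact/L1Z/L1_cosM.
- exact/L1Z/L1_sinM.
by apply: eq_Rintegral => x' _; rewrite mulrBl cosB; ring.
Qed.

Let G_le x y : `|G x y| <= 2 * M.
Proof.
rewrite /G (le_trans (ler_normD _ _))// mulr_natl mulr2n.
apply: lerD; rewrite normrM.
  rewrite (le_trans _ (cos_transform_le y))// ler_piMl// norm_cos_le1//.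
by rewrite (le_trans _ (sin_transform_le y))// ler_piMl// norm_sin_le1.
Qed.

Let mG : measurable_fun setT (fun z : T * T => G z.1 z.2).
Proof.
apply: measurable_funD; apply: measurable_funM.
- exact: measurable_cosM.
- by apply: measurableT_comp => //; exact: measurable_cos_transform.
- exact: measurable_sinM.
- by apply: measurableT_comp => //; exact: measurable_sin_transform.
Qed.

Let power_spectrumE y : power_spectrum y = \int[mu]_x (f x * G x y).
Proof.
transitivity (\int[mu]_x (cos_transform f y * (cos (x * y) * f x) +
    sin_transform f y * (sin (x * y) * f x))).
  rewrite RintegralD//; [|exact/L1Z/L1_cosM|exact/L1Z/L1_sinM].
  by rewrite !RintegralZl//; [exact: L1_sinM|exact: L1_cosM].
by apply: eq_Rintegral => x _; rewrite /G; ring.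
Qed.

Section weighted.
Variable e : R.
Hypothesis e0 : 0 < e.

Let w (y : T) := expR (- (e * `|y|)).
Let w1 : L1 mu w. Proof. exact: L1_poisson_weight. Qed.
Let mw : measurable_fun setT w. Proof. exact: L1_measurable w1. Qed.

Lemma L1_weighted_spectrum : L1 mu (fun y => w y * power_spectrum y).
Proof.
apply: (@L1_le _ T R mu _ (fun y => (M ^+ 2 + M ^+ 2) * w y)); last exact: L1Z.
  by apply: measurable_funM => //; exact: measurable_power_spectrum.
move=> y; rewrite ger0_norm ?mulr_ge0 ?expR_ge0 ?power_spectrum_ge0//.
rewrite mulrC ler_wpM2r ?expR_ge0// /power_spectrum lerD// sqr_normr_le//.
  exact: cos_transform_le.
exact: sin_transform_le.
Qed.

(** For fixed x the weight turns the cosine of the phase difference into the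
   Poisson kernel; the substitution x' = e s + x makes the kernel independent
   of e. *)
Let inner x : \int[mu]_y (w y * G x y) =
  \int[mu]_s (cauchy_kernel s * f (e * s + x)).
Proof.
transitivity (\int[mu]_y \int[mu]_x' (w y * (f x' * cos ((x' - x) * y)))).
  apply: eq_Rintegral => y _; rewrite GE RintegralZl//.
  have := @L1_bounded _ T R mu (fun x' => cos ((x' - x) * y)) 1 f _ _ f1.
  move=> /(_ _ _)/eq_integrable; apply => //.
  - by move=> x' _ /=; rewrite mulrC.
  - by apply: measurable_cosM => //; exact: measurable_funB.
  - by move=> x'; exact: norm_cos_le1.
rewrite (Rfubini (m1 := mu) (m2 := mu)
  (f := fun z : T * T => w z.1 * (f z.2 * cos ((z.2 - x) * z.1))))/=; last first.
  apply: L1_le (L1_norm (L1_tensor w1 f1)).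
    apply: measurable_funM; first exact: measurableT_comp.
    apply: measurable_funM; first exact: measurableT_comp.
    by apply: measurable_cosM => //; exact: measurable_funB.
  by move=> z /=; rewrite mulrA normrM ler_piMr// norm_cos_le1.
transitivity (\int[mu]_x' (f x' * (2 * e / (e ^+ 2 + ((x' : R) - x) ^+ 2)))).
  apply: eq_Rintegral => x' _; rewrite -(cos_transform_poisson e0) -RintegralZl//.
    by apply: eq_Rintegral => y _; rewrite mulrCA.
  apply: (@L1_le _ T R mu _ w) => //.
    by apply: measurable_funM => //; exact: measurable_cosM.
  move=> y; rewrite normrM ger0_norm ?expR_ge0// ler_piMr ?expR_ge0//.
  exact: norm_cos_le1.
have d0 t : 0 < e ^+ 2 + t ^+ 2 by rewrite ltr_wpDr ?sqr_ge0// exprn_gt0.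
have h1 : L1 mu (fun x' : T => f x' * (2 * e / (e ^+ 2 + ((x' : R) - x) ^+ 2))).
  have := @L1_bounded _ T R mu
    (fun x' => e * e^-1 ^+ 2 * cauchy_kernel ((x' - x) / e)) (e * e^-1 ^+ 2 * 2) f _ _ f1.
  move=> /(_ _ _)/eq_integrable; apply => //.
  - move=> x' _ /=; rewrite /cauchy_kernel; congr EFin.
    have := d0 (x' - x) => /lt0r_neq0 H.
    field.
    by rewrite H gt_eqF.
  - apply: measurable_funM => //.
    apply: measurableT_comp; first exact: measurable_cauchy_kernel.
    by apply: measurable_funM => //; exact: measurable_funB.
  - have c0 : 0 <= e * e^-1 ^+ 2 by rewrite mulr_ge0 ?sqr_ge0// ltW.
    move=> x'; rewrite ger0_norm; first by rewrite ler_wpM2l ?cauchy_kernel_le2.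
    by rewrite mulr_ge0// cauchy_kernel_ge0.
have := Rintegral_affine x e0 h1.
move=> /(congr1 (fun z => e * z)); rewrite mulrA divff ?gt_eqF// mul1r => <-.
rewrite -RintegralZl//; last exact: L1_affine h1.
apply: eq_Rintegral => s _; rewrite addrK /cauchy_kernel.
have := d0 (e * s) => /lt0r_neq0 H.
have H' : 1 + s ^+ 2 != 0 by rewrite gt_eqF// ltr_pwDl// sqr_ge0.
by field; rewrite H H'.
Qed.

Hypothesis f2 : L1 mu (fun x => f x ^+ 2).

Definition autocorrelation (t : R) := \int[mu]_x (f x * f (t + x)).

Let mfs : measurable_fun setT (fun z : T * T => f (e * z.1 + z.2)).
Proof.
apply: (measurableT_comp (f := f) (g := fun z : T * T => e * z.1 + z.2 : T)) => //.
by apply: measurable_funD => //; apply: measurable_funM.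
Qed.

Let L1_kernel_product :
  L1 (mu \x mu)%E (fun z : T * T => f z.2 * (cauchy_kernel z.1 * f (e * z.1 + z.2))).
Proof.
have mk1 : measurable_fun setT (fun z : T * T => cauchy_kernel z.1).
  by apply: measurableT_comp => //; exact: measurable_cauchy_kernel.
pose F (z : T * T) := cauchy_kernel z.1 * f z.2 ^+ 2.
pose H (z : T * T) := cauchy_kernel z.1 * f (e * z.1 + z.2) ^+ 2.
have F1 : L1 (mu \x mu)%E F := L1_tensor L1_cauchy_kernel f2.
have H1 : L1 (mu \x mu)%E H.
  apply: L1_prod; first by apply: measurable_funM => //; exact: measurable_funX.
  have E s : (\int[mu]_x (`|H (s, x)|)%:E =
      (cauchy_kernel s * \int[mu]_x f x ^+ 2)%:E)%E.
    have fs : L1 mu (fun x => f (x + e * s) ^+ 2) := L1_shift (e * s) f2.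
    rewrite -(Rintegral_shift (e * s) f2) -RintegralZl// EFin_Rintegral//; last exact: L1Z.
    apply: eq_integral => x _; rewrite /H/= ger0_norm; first by rewrite addrC.
    by rewrite mulr_ge0 ?cauchy_kernel_ge0 ?sqr_ge0.
  under eq_integral do rewrite E mulrC.
  by rewrite -EFin_Rintegral ?ltry//; apply: L1Z; exact: L1_cauchy_kernel.
apply: L1_le (L1D F1 H1).
  apply: measurable_funM; first exact: measurableT_comp.
  exact: measurable_funM.
move=> z; rewrite /F /H -mulrDr mulrCA normrM ger0_norm ?cauchy_kernel_ge0//.
rewrite ler_wpM2l ?cauchy_kernel_ge0//.
move: (f _) (f _) => a b; rewrite ler_norml; apply/andP; split.
  have := sqr_ge0 (a + b); have := sqr_ge0 a; have := sqr_ge0 b; nra.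
have := sqr_ge0 (a - b); have := sqr_ge0 a; have := sqr_ge0 b; nra.
Qed.

(** Fubini exchanges the frequency integral with each of the two copies of [f]
    in the squared transform, and [inner] evaluates it; a third exchange brings
    the variable [s] of the kernel outside. *)
Lemma weighted_spectrumE : \int[mu]_y (w y * power_spectrum y) =
  \int[mu]_s (cauchy_kernel s * autocorrelation (e * s)).
Proof.
transitivity (\int[mu]_y \int[mu]_x (w y * (f x * G x y))).
  apply: eq_Rintegral => y _; rewrite power_spectrumE RintegralZl//.
  have := @L1_bounded _ T R mu (fun x => G x y) (2 * M) f _ _ f1.
  move=> /(_ _ _)/eq_integrable; apply => //.
  - by move=> x _ /=; rewrite mulrC.
  - exact: (measurableT_comp mG (measurable_pair2 y)).
rewrite (Rfubini (m1 := mu) (m2 := mu)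
  (f := fun z : T * T => w z.1 * (f z.2 * G z.2 z.1)))/=; last first.
  apply: L1_le (L1Z (2 * M) (L1_norm (L1_tensor w1 f1))).
    apply: measurable_funM; first exact: measurableT_comp.
    apply: measurable_funM; first exact: measurableT_comp.
    apply: (measurableT_comp (f := fun z : T * T => G z.1 z.2)
      (g := fun z : T * T => (z.2, z.1))) => //.
    exact: (measurable_fun_pair measurable_snd measurable_fst).
  by move=> z /=; rewrite mulrA normrM mulrC ler_wpM2r.
transitivity (\int[mu]_x \int[mu]_s (f x * (cauchy_kernel s * f (e * s + x)))).
  apply: eq_Rintegral => x _.
  rewrite [RHS]RintegralZl//; last first.
    have := @L1_bounded _ T R mu cauchy_kernel 2 (fun s => f (e * s + x)) _ _ _.
    apply => //; [exact: measurable_cauchy_kernel| |exact: L1_affine].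
    by move=> s; rewrite ger0_norm ?cauchy_kernel_ge0 ?cauchy_kernel_le2.
  rewrite -inner -RintegralZl//; last first.
    have := @L1_bounded _ T R mu (fun y => G x y) (2 * M) w _ _ w1.
    move=> /(_ _ _)/eq_integrable; apply => //.
    + by move=> y _ /=; rewrite mulrC.
    + exact: (measurableT_comp mG (measurable_pair1 x)).
  by apply: eq_Rintegral => y _; rewrite mulrCA.
rewrite -(Rfubini (m1 := mu) (m2 := mu) L1_kernel_product)/=.
apply: eq_Rintegral => s _; rewrite /autocorrelation -RintegralZl//; last first.
  apply: L1_mul => //.
    apply: (measurableT_comp (f := f) (g := fun x : T => e * s + x : T)) => //.
    exact: measurable_funD.
  by under [X in L1 mu X]eq_fun do rewrite addrC; exact: (L1_shift (e * s) f2).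
by apply: eq_Rintegral => x _; rewrite mulrCA.
Qed.

End weighted.
End transforms.

Section conclusion.
Variable f : T -> R.
Hypothesis f1 : L1 mu f.
Hypothesis f2 : L1 mu (fun x => f x ^+ 2).

Let mf : measurable_fun setT f. Proof. exact: L1_measurable f1. Qed.

Let E2 := \int[mu]_x f x ^+ 2.

Let f2t (t : R) : L1 mu (fun x => f (t + x) ^+ 2).
Proof. by under [X in L1 mu X]eq_fun do rewrite addrC; exact: (L1_shift t f2). Qed.

Let Ef2t (t : R) : \int[mu]_x f (t + x) ^+ 2 = E2.
Proof.
by rewrite /E2 -(Rintegral_shift t f2); apply: eq_Rintegral => x _; rewrite addrC.
Qed.

Let mft (t : R) : measurable_fun setT (fun x : T => f (t + x)).
Proof.
apply: (measurableT_comp (f := f) (g := fun x : T => t + x : T)) => //.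
exact: measurable_funD.
Qed.

Let ff1 (t : R) : L1 mu (fun x => f x * f (t + x)).
Proof. by apply: L1_mul. Qed.

Let autocorrelation_le t : `|autocorrelation f t| <= E2.
Proof.
apply: (le_trans (le_normr_Rintegral measurableT (ff1 t))).
have D1 := L1Z (2^-1) (L1D f2 (f2t t)).
rewrite (_ : E2 = \int[mu]_x (2^-1 * (f x ^+ 2 + f (t + x) ^+ 2))).
  apply: le_Rintegral => //; first exact: L1_norm.
  move=> x _; move: (f _) (f _) => a b; rewrite ler_norml; apply/andP; split.
    by have := sqr_ge0 (a + b); lra.
  by have := sqr_ge0 (a - b); lra.
by rewrite RintegralZl ?RintegralD ?Ef2t// -/E2; [lra|exact: L1D].
Qed.

(** Continuity of the autocorrelation at [0] is thereby a statement about
    translations in L2. *)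
Let autocorrelationE t :
  autocorrelation f t = E2 - 2^-1 * \int[mu]_x (f (x + t) - f x) ^+ 2.
Proof.
transitivity (\int[mu]_x (2^-1 * (f x ^+ 2 + f (t + x) ^+ 2) -
    2^-1 * (f (x + t) - f x) ^+ 2)).
  by apply: eq_Rintegral => x _; rewrite (addrC x t); field.
have D1 : L1 mu (fun x => (f (x + t) - f x) ^+ 2).
  apply: (@L1_le _ T R mu _ (fun x => 2 * f x ^+ 2 + 2 * f (t + x) ^+ 2)).
  - apply: measurable_funX; apply: measurable_funB => //.
    exact: measurable_shift.
  - move=> x; rewrite (addrC x t) ger0_norm ?sqr_ge0//.
    by have := sqr_ge0 (f (t + x) + f x); lra.
  - by apply: L1D; exact: L1Z.
rewrite RintegralB//; [|by apply: L1Z; exact: L1D|exact: L1Z].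
rewrite !RintegralZl//; last exact: L1D.
by rewrite RintegralD// Ef2t -/E2; lra.
Qed.

Let eps (n : nat) : R := n.+1%:R^-1.

Let eps_gt0 n : 0 < eps n. Proof. by rewrite /eps. Qed.

Let cvg_eps : eps n @[n --> \oo] --> 0.
Proof. exact: cvg_harmonic. Qed.

Let cvg_autocorrelation (s : R) :
  autocorrelation f (eps n * s) @[n --> \oo] --> E2.
Proof.
have {1}-> : E2 = E2 - 2^-1 * 0 by rewrite mulr0 subr0.
under eq_cvg do rewrite autocorrelationE.
apply: cvgB; first exact: cvg_cst.
apply: cvgM; first exact: cvg_cst.
apply: (L2_translation_cvg (B := `|s|)) => //.
  move=> n; rewrite normrM ler_piMl// ger0_norm ?(ltW (eps_gt0 _))//.
  by rewrite /eps invf_le1// ler1n.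
by rewrite -[X in _ --> X](mul0r s); apply: cvgM => //; exact: cvg_cst.
Qed.

Let cvg_weighted_spectrum :
  \int[mu]_y (expR (- (eps n * `|y|)) * power_spectrum f y) @[n --> \oo]
    --> 2 * pi * E2.
Proof.
have -> : 2 * pi * E2 = \int[mu]_s (E2 * cauchy_kernel s).
  rewrite RintegralZl//; last exact: L1_cauchy_kernel.
  by rewrite [X in _ = _ * X]/Rintegral integral_cauchy_kernel /= mulrC.
under eq_cvg do rewrite weighted_spectrumE//.
apply: (@Rdominated_cvg _ T R mu _ _ (fun s => E2 * cauchy_kernel s)).
- move=> n; apply: measurable_funM; first exact: measurable_cauchy_kernel.
  apply: (measurable_Rintegral mu (f := fun z : T * T => f z.2 * f (eps n * z.1 + z.2))).
  apply: measurable_funM; first exact: measurableT_comp.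
  apply: (measurableT_comp (f := f) (g := fun z : T * T => eps n * z.1 + z.2 : T)) => //.
  by apply: measurable_funD => //; apply: measurable_funM.
- move=> s; rewrite mulrC; apply: cvgM; first exact: cvg_cst.
  exact: cvg_autocorrelation.
- by apply: L1Z; exact: L1_cauchy_kernel.
- by move=> n s; rewrite normrM mulrC ler_pM// ger0_norm ?cauchy_kernel_ge0.
Qed.

(** As the Poisson weight increases to [1], monotone convergence on the frequency
    side meets continuity of the autocorrelation at [0] on the space side. *)
Theorem scalar_plancherel :
  (\int[mu]_y (power_spectrum f y)%:E = (2 * pi * E2)%:E)%E.
Proof.
pose g n y := (expR (- (eps n * `|y|)) * power_spectrum f y)%:E.
have mg n : measurable_fun setT (g n : T -> \bar R).
  by apply/measurable_EFinP; exact: L1_measurable (L1_weighted_spectrum f1 (eps_gt0 n)).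
have g0 n y : (0 <= g n y)%E.
  by rewrite lee_fin mulr_ge0 ?expR_ge0 ?power_spectrum_ge0.
have ndg y : nondecreasing_seq (g ^~ y).
  move=> m n mn; rewrite lee_fin ler_wpM2r ?power_spectrum_ge0// ler_expR lerN2.
  by rewrite ler_wpM2r// /eps lef_pV2 ?posrE// ler_nat.
have gl y : limn (g ^~ y) = (power_spectrum f y)%:E.
  apply/cvg_lim => //; apply: cvg_EFin; first exact: nearW.
  rewrite -[X in _ --> X]mul1r; apply: cvgM; last exact: cvg_cst.
  rewrite -expR0; apply: continuous_cvg; first exact: continuous_expR.
  rewrite -oppr0; apply: cvgN; rewrite -(mul0r `|y|); apply: cvgM => //.
  exact: cvg_cst.
under eq_integral do rewrite -gl.
rewrite monotone_convergence//.
apply/cvg_lim => //.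
rewrite (_ : (fun n => _) =
  EFin \o (fun n => \int[mu]_y (expR (- (eps n * `|y|)) * power_spectrum f y))).
  by apply: cvg_EFin; [exact: nearW|exact: cvg_weighted_spectrum].
by apply/funext => n /=; rewrite EFin_Rintegral//; exact: L1_weighted_spectrum.
Qed.

End conclusion.
End scalar_plancherel.

(** * Functions with values in the Clifford algebra *)

Section clifford_functions.
Context {R : realType} {m : nat}.
Local Notation V := (clifford R m).
Implicit Types (A B : V) (J : {linear V -> V}).

Definition sqnorm A : R := \sum_S coef A S ^+ 2.
Definition l1norm A : R := \sum_S `|coef A S|.

Lemma sqnorm_ge0 A : 0 <= sqnorm A.
Proof. by apply: sumr_ge0 => S _; exact: sqr_ge0. Qed.

Lemma l1norm_ge0 A : 0 <= l1norm A.
Proof. exact: sumr_ge0. Qed.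

Lemma coef_le_l1norm A S : `|coef A S| <= l1norm A.
Proof. by rewrite /l1norm (bigD1 S)//= lerDl sumr_ge0. Qed.

Lemma sqr_coef_le_sqnorm A S : coef A S ^+ 2 <= sqnorm A.
Proof. by rewrite /sqnorm (bigD1 S)//= lerDl sumr_ge0// => T _; exact: sqr_ge0. Qed.

Lemma sqnorm_le_l1norm A : sqnorm A <= l1norm A ^+ 2.
Proof.
rewrite expr2 [X in X * _]/l1norm mulr_suml; apply: ler_sum => S _.
by rewrite -real_normK ?num_real// expr2 ler_wpM2l// coef_le_l1norm.
Qed.

Lemma sqnorm_parallelogram A B : sqnorm (A - B) + sqnorm (A + B) = 2 * (sqnorm A + sqnorm B).
Proof.
rewrite /sqnorm -!big_split/= mulr_sumr; apply: eq_bigr => S _.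
by rewrite !coefD coefN; ring.
Qed.

Lemma sqnormZ (c : R) A : sqnorm (c *: A) = c ^+ 2 * sqnorm A.
Proof. by rewrite /sqnorm mulr_sumr; apply: eq_bigr => S _; rewrite coefZ exprMn. Qed.

Lemma clifford_basis A : A = \sum_S coef A S *: blade R S.
Proof.
apply/cliffP => T; rewrite coef_sum (bigD1 T)//= coefZ coef_blade eqxx mulr1.
by rewrite big1 ?addr0// => S ST; rewrite coefZ coef_blade eq_sym (negPf ST) mulr0.
Qed.

Lemma coef_linear J A S : coef (J A) S = \sum_T coef (J (blade R T)) S * coef A T.
Proof.
rewrite {1}(clifford_basis A) linear_sum coef_sum; apply: eq_bigr => T _.
by rewrite linearZ/= coefZ mulrC.
Qed.

Definition isometric J := forall A, sqnorm (J A) = sqnorm A.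

Lemma coef_isometry_le J A S : isometric J -> `|coef (J A) S| <= l1norm A.
Proof.
move=> iJ; rewrite -(@ler_pXn2r _ 2)// ?nnegrE ?l1norm_ge0//.
rewrite real_normK ?num_real// (le_trans (sqr_coef_le_sqnorm _ _))// iJ.
exact: sqnorm_le_l1norm.
Qed.

(** Left (or right) multiplication by [cos t - sin t B], [J] being
    multiplication by [B]. *)
Definition rotor J (t : R) A : V := cos t *: A - sin t *: J A.

Lemma coef_rotor J t A S : coef (rotor J t A) S = cos t * coef A S - sin t * coef (J A) S.
Proof. by rewrite /rotor coefD coefN !coefZ. Qed.

Lemma l1norm_rotor J t A : isometric J ->
  l1norm (rotor J t A) <= (2 * #|{set 'I_m}|)%:R * l1norm A.
Proof.
move=> iJ; rewrite /l1norm.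
apply: (@le_trans _ _ (\sum_(S : {set 'I_m}) 2 * l1norm A)).
  apply: ler_sum => S _; rewrite coef_rotor (le_trans (ler_normB _ _))// !normrM.
  rewrite mulr_natl mulr2n lerD//.
    by rewrite (le_trans _ (coef_le_l1norm A S))// ler_piMl// norm_cos_le1.
  by rewrite (le_trans _ (coef_isometry_le A S iJ))// ler_piMl// norm_sin_le1.
by rewrite sumr_const -/(l1norm A) natrM -[leLHS]mulr_natl mulrA (mulrC _ 2).
Qed.

Section measurability.
Context d (X : measurableType d).
Implicit Types f g : X -> V.

(** The notions [Vmeas], [VL1] and [Vint] are coefficientwise, on any measure
    space: the partial transforms live on products. *)
Definition Vmeas f := forall S, measurable_fun setT (fun x => coef (f x) S).

Lemma Vmeas_linear J f : Vmeas f -> Vmeas (fun x => J (f x)).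
Proof.
move=> mf S; under eq_fun do rewrite coef_linear.
by apply: measurable_sum => T; apply: measurable_funM.
Qed.

Lemma Vmeas_rotor J (t : X -> R) f : measurable_fun setT t -> Vmeas f ->
  Vmeas (fun x => rotor J (t x) (f x)).
Proof.
move=> mt mf S; under eq_fun do rewrite coef_rotor.
apply: measurable_funB; apply: measurable_funM => //.
- by apply: measurableT_comp => //; apply: continuous_measurable_fun; exact: continuous_cos.
- by apply: measurableT_comp => //; apply: continuous_measurable_fun; exact: continuous_sin.
- exact: Vmeas_linear.
Qed.

Lemma measurable_sqnorm f : Vmeas f -> measurable_fun setT (fun x => sqnorm (f x)).
Proof. by move=> mf; apply: measurable_sum => S; exact: measurable_funX. Qed.

Variable mu : {measure set X -> \bar R}.

Definition VL1 f := forall S, L1 mu (fun x => coef (f x) S).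

Definition Vint f : V := mkcliff (fun S => \int[mu]_x coef (f x) S).

Lemma coef_Vint f S : coef (Vint f) S = \int[mu]_x coef (f x) S.
Proof. exact: coefE. Qed.

Lemma VL1_meas f : VL1 f -> Vmeas f.
Proof. by move=> f1 S; exact: L1_measurable (f1 S). Qed.

Lemma VL1_l1norm f : VL1 f -> L1 mu (fun x => l1norm (f x)).
Proof. by move=> f1; apply: L1_sum => S; exact: L1_norm. Qed.

Lemma VL1_le f (h : X -> R) : Vmeas f -> L1 mu h -> (forall x, l1norm (f x) <= h x) -> VL1 f.
Proof.
move=> mf h1 fh S; apply: L1_le h1 => // x.
exact: le_trans (coef_le_l1norm _ _) (fh x).
Qed.

Lemma Vint_linear J f : VL1 f -> Vint (fun x => J (f x)) = J (Vint f).
Proof.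
move=> f1; apply/cliffP => S; rewrite coef_Vint coef_linear.
under eq_Rintegral do rewrite coef_linear.
rewrite Rintegral_sum; last by move=> T; exact: L1Z.
by apply: eq_bigr => T _; rewrite RintegralZl// coef_Vint.
Qed.

Lemma Vint_rotor J t f : VL1 f -> Vint (fun x => rotor J t (f x)) = rotor J t (Vint f).
Proof.
move=> f1; apply/cliffP => S; rewrite coef_Vint coef_rotor -Vint_linear// !coef_Vint.
have J1 : L1 mu (fun x => coef (J (f x)) S).
  under [X in L1 mu X]eq_fun do rewrite coef_linear.
  by apply: L1_sum => T; exact: L1Z.
under eq_Rintegral do rewrite coef_rotor.
rewrite RintegralB//; [|exact: L1Z|exact: L1Z].
by rewrite !RintegralZl.
Qed.

Lemma L1_coef_sqr f S : Vmeas f -> L1 mu (fun x => sqnorm (f x)) ->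
  L1 mu (fun x => coef (f x) S ^+ 2).
Proof.
move=> mf; apply: L1_le; first exact: measurable_funX.
by move=> x; rewrite ger0_norm ?sqr_ge0// sqr_coef_le_sqnorm.
Qed.

End measurability.
End clifford_functions.

Section vector_line.
Context {R : realType} {m : nat}.
Local Notation V := (clifford R m).
Local Notation mu := (@lebesgue_measure R).
Local Notation T := (measurableTypeR R).
Variables (J : {linear V -> V}) (w : T -> V).
Hypothesis iJ : isometric J.
Hypothesis w1 : VL1 mu w.
Hypothesis w2 : L1 mu (fun x => sqnorm (w x)).

Let c S x := coef (w x) S.

Let C y : V := mkcliff (fun S => cos_transform (c S) y).
Let D y : V := mkcliff (fun S => sin_transform (c S) y).

Let transformE (y : R) : Vint mu (fun x : T => rotor J (x * y) (w x)) = C y - J (D y).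
Proof.
apply/cliffP => S; rewrite coef_Vint coefD coefN coef_linear.
rewrite (_ : coef (C y) S = \int[mu]_x (cos (x * y) * c S x)); last exact: coefE.
under [X in _ - X]eq_bigr => U _.
  rewrite (_ : coef (D y) U = \int[mu]_x (sin (x * y) * c U x)); last exact: coefE.
  rewrite -RintegralZl//; last exact: L1_sinM (w1 U) y.
  over.
rewrite /= -Rintegral_sum; last by move=> U; apply: L1Z; exact: L1_sinM (w1 U) y.
rewrite -RintegralB//; [|exact: L1_cosM (w1 S) y|].
  apply: eq_Rintegral => x _; rewrite coef_rotor coef_linear mulr_sumr.
  by congr (_ - _); apply: eq_bigr => U _; rewrite mulrCA.
by apply: L1_sum => U; apply: L1Z; exact: L1_sinM (w1 U) y.
Qed.

Let CN y : C (- y) = C y.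
Proof.
apply/cliffP => S; rewrite !coefE /cos_transform.
by apply: eq_Rintegral => x _; rewrite mulrN cosN.
Qed.

Let DN y : D (- y) = - D y.
Proof.
apply/cliffP => S; rewrite coefN !coefE /sin_transform -[RHS]mulN1r -RintegralZl//.
  by apply: eq_Rintegral => x _; rewrite mulrN sinN mulNr mulN1r.
exact: L1_sinM (w1 S) y.
Qed.

(** The cross term between the cosine part and the sine part is odd in the
    frequency, so averaging over [y] and [- y] and the parallelogram law leave
    the sum of the scalar power spectra of the coefficients. *)
Theorem vector_plancherel :
  (\int[mu]_y (sqnorm (Vint mu (fun x : T => rotor J (x * y) (w x))))%:E =
   (2 * pi)%:E * \int[mu]_x (sqnorm (w x))%:E)%E.
Proof.
under eq_integral do rewrite transformE.
have mw := VL1_meas w1.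
have mC : Vmeas C.
  by move=> S; under eq_fun do rewrite coefE; exact: measurable_cos_transform (w1 S).
have mD : Vmeas D.
  by move=> S; under eq_fun do rewrite coefE; exact: measurable_sin_transform (w1 S).
pose I := (\int[mu]_y (sqnorm (C y - J (D y)))%:E)%E.
have mCD : measurable_fun setT (fun y => (sqnorm (C y - J (D y)))%:E).
  apply/measurable_EFinP; apply: measurable_sqnorm => S.
  under eq_fun do rewrite coefD coefN.
  by apply: measurable_funB => //; exact: Vmeas_linear.
have IN : I = (\int[mu]_y (sqnorm (C y + J (D y)))%:E)%E.
  rewrite /I -ge0_integral_reflect//; last by move=> y; rewrite lee_fin sqnorm_ge0.
  by apply: eq_integral => y _; rewrite CN DN linearN opprK.
have II : (I + I = (2 * (2 * pi * \int[mu]_x sqnorm (w x)))%:E)%E.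
  rewrite {2}IN /I -ge0_integralD//; last 3 first.
  - by move=> y _; rewrite lee_fin sqnorm_ge0.
  - by move=> y _; rewrite lee_fin sqnorm_ge0.
  - apply/measurable_EFinP; apply: measurable_sqnorm => S.
    under eq_fun do rewrite coefD.
    by apply: measurable_funD => //; exact: Vmeas_linear.
  transitivity (\int[mu]_y (\sum_S (2 * power_spectrum (c S) y)%:E))%E.
    apply: eq_integral => y _; rewrite -EFinD sqnorm_parallelogram iJ sumEFin; congr EFin.
    rewrite -mulr_sumr; congr (_ * _); rewrite /sqnorm -big_split/=.
    by apply: eq_bigr => S _; rewrite !coefE.
  rewrite ge0_integral_sum//; last 2 first.
  - move=> S; apply/measurable_EFinP; apply: measurable_funM => //.
    exact: measurable_power_spectrum (w1 S).
  - by move=> S y _; rewrite lee_fin mulr_ge0// power_spectrum_ge0.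
  rewrite Rintegral_sum; last by move=> S; exact: L1_coef_sqr.
  rewrite !mulr_sumr -sumEFin; apply: eq_bigr => S _.
  under eq_integral do rewrite EFinM.
  rewrite ge0_integralZl//; last 2 first.
  - by apply/measurable_EFinP; exact: measurable_power_spectrum (w1 S).
  - by move=> y _; rewrite lee_fin power_spectrum_ge0.
  by rewrite (scalar_plancherel (w1 S))//; exact: L1_coef_sqr.
rewrite -(EFin_Rintegral w2) -EFinM -/I.
have I0 : (0 <= I)%E by apply: integral_ge0 => y _; rewrite lee_fin sqnorm_ge0.
move: I I0 II {IN} => [r| |]// _ [] II; congr EFin.
lra.
Qed.

End vector_line.

(** * Iterated integrals over R^n *)

Lemma eq_Rintegral_ae d (T : measurableType d) (R : realType)
    (mu : {measure set T -> \bar R}) (f g : T -> R) :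
  measurable_fun setT f -> measurable_fun setT g ->
  {ae mu, forall x, f x = g x} -> \int[mu]_x f x = \int[mu]_x g x.
Proof.
move=> mf mg fg; congr fine; apply: ae_eq_integral => //.
- exact/measurable_EFinP.
- exact/measurable_EFinP.
- by apply: filterS fg => x /= ->.
Qed.

Lemma ae_L1_section d1 d2 (T1 : measurableType d1) (T2 : measurableType d2)
    (R : realType) (m1 : {sigma_finite_measure set T1 -> \bar R})
    (m2 : {sigma_finite_measure set T2 -> \bar R}) (f : T1 * T2 -> R) :
  L1 (m1 \x m2)%E f -> {ae m1, forall x, L1 m2 (fun y => f (x, y))}.
Proof. exact: ae_integrable1. Qed.

Section tuple_measure.
Context {R : realType} (k : nat).
Local Notation P := (@lebesgue_measure R \x lebesgue_borel R k)%E.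
Local Notation mu := (lebesgue_borel R k.+1).

Lemma ge0_integral_tuple_cons (f : k.+1.-tuple R -> \bar R) :
  measurable_fun setT f -> (forall x, 0 <= f x)%E ->
  (\int[mu]_x f x = \int[P]_z f (tuple_cons z))%E.
Proof.
move=> mf f0.
rewrite -[LHS]/(\int[pushforward P (@tuple_cons R k)]_x f x)%E.
by rewrite ge0_integral_pushforward//; exact: measurable_tuple_cons.
Qed.

Lemma L1_tuple_cons (f : k.+1.-tuple R -> R) :
  L1 mu f -> L1 P (fun z => f (tuple_cons z)).
Proof.
case/integrableP => mf foo; apply/integrableP; split.
  by apply: (measurableT_comp mf); exact: measurable_tuple_cons.
rewrite -(ge0_integral_tuple_cons (f := fun x => `|(f x)%:E|%E))//.
exact: measurableT_comp.
Qed.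

Lemma Rintegral_tuple_cons (f : k.+1.-tuple R -> R) : L1 mu f ->
  \int[mu]_x f x = \int[P]_z f (tuple_cons z).
Proof.
move=> f1; congr fine.
rewrite -[LHS]/(\int[pushforward P (@tuple_cons R k)]_x (EFin \o f) x)%E.
rewrite integral_pushforward//.
- exact: measurable_tuple_cons.
- exact: measurable_int f1.
- exact: L1_tuple_cons.
Qed.

End tuple_measure.

Section phase_operator.
Context {R : realType} {m : nat}.
Local Notation V := (clifford R m).

(** Multiplication by the exponential of minus the phase, as one rotor for each
    coordinate; the recursion follows that of [lebesgue_borel]. *)
Fixpoint phase_op k : ('I_k -> {linear V -> V}) -> k.-tuple R -> k.-tuple R -> V -> V :=
  match k with
  | 0 => fun _ _ _ A => A
  | k'.+1 => fun J x y A => rotor (J ord0) (thead x * thead y)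
      (phase_op (fun i => J (lift ord0 i)) [tuple of behead x] [tuple of behead y] A)
  end.

Lemma phase_op_cons k (J : 'I_k.+1 -> {linear V -> V}) (u v : R * k.-tuple R) A :
  phase_op J (tuple_cons u) (tuple_cons v) A =
  rotor (J ord0) (u.1 * v.1) (phase_op (fun i => J (lift ord0 i)) u.2 v.2 A).
Proof.
have beheadE (p : measurableTypeR R * k.-tuple R) :
  [tuple of behead (tuple_cons p)] = p.2 by exact: val_inj.
by rewrite /= !beheadE /tuple_cons !theadE.
Qed.

Lemma Vmeas_phase_op d (X : measurableType d) k (J : 'I_k -> {linear V -> V})
    (a b : X -> k.-tuple R) (f : X -> V) :
  measurable_fun setT a -> measurable_fun setT b -> Vmeas f ->
  Vmeas (fun x => phase_op J (a x) (b x) (f x)).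
Proof.
elim: k J a b => [//|k IHk] J a b ma mb mf /=.
apply: Vmeas_rotor.
  apply: measurable_funM; apply: measurableT_comp => //.
    exact: (@measurable_tnth _ R k.+1 ord0).
  exact: (@measurable_tnth _ R k.+1 ord0).
apply: IHk => //; apply: (measurableT_comp (@measurable_behead _ R k)) => //.
Qed.

Lemma l1norm_phase_op k (J : 'I_k -> {linear V -> V}) x y A :
  (forall i, isometric (J i)) ->
  l1norm (phase_op J x y A) <= ((2 * #|{set 'I_m}|)%:R ^+ k) * l1norm A.
Proof.
elim: k J x y => [|k IHk] J x y iJ /=; first by rewrite expr0 mul1r.
rewrite (le_trans (l1norm_rotor _ _ (iJ _)))// exprS -mulrA ler_wpM2l//.
by apply: IHk => i; exact: iJ.
Qed.

Lemma VL1_phase_op d (X : measurableType d) (mu : {measure set X -> \bar R})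
    k (J : 'I_k -> {linear V -> V}) (a b : X -> k.-tuple R) (f : X -> V) :
  (forall i, isometric (J i)) ->
  measurable_fun setT a -> measurable_fun setT b -> VL1 mu f ->
  VL1 mu (fun x => phase_op J (a x) (b x) (f x)).
Proof.
move=> iJ ma mb f1.
apply: (@VL1_le _ _ _ _ _ _ (fun x => (2 * #|{set 'I_m}|)%:R ^+ k * l1norm (f x))).
- by apply: Vmeas_phase_op => //; exact: VL1_meas f1.
- by apply: L1Z; exact: VL1_l1norm.
- by move=> x; exact: l1norm_phase_op.
Qed.

Lemma Vmeas_Vint d1 d2 (X : measurableType d1) (Y : measurableType d2)
    (mu : {sigma_finite_measure set Y -> \bar R}) (f : X * Y -> V) :
  Vmeas f -> Vmeas (fun x => Vint mu (fun y => f (x, y))).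
Proof.
move=> mf S; under eq_fun do rewrite coef_Vint.
exact: (measurable_Rintegral mu (mf S)).
Qed.

End phase_operator.

Section iterated_plancherel.
Context {R : realType} {m : nat}.
Local Notation V := (clifford R m).
Local Notation T := (measurableTypeR R).

Definition phase_transform k (J : 'I_k -> {linear V -> V}) (f : k.-tuple R -> V)
  (y : k.-tuple R) : V := Vint (lebesgue_borel R k) (fun x => phase_op J x y (f x)).

Lemma Vmeas_phase_transform k (J : 'I_k -> {linear V -> V}) f :
  Vmeas f -> Vmeas (phase_transform J f).
Proof.
move=> mf; apply: (Vmeas_Vint (lebesgue_borel R k)
  (f := fun z : k.-tuple R * k.-tuple R => phase_op J z.2 z.1 (f z.2))).
by apply: Vmeas_phase_op => // S; exact: (measurableT_comp (mf S)).
Qed.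

Section step.
Variables (k : nat) (J : 'I_k.+1 -> {linear V -> V}) (f : k.+1.-tuple R -> V).
Hypothesis iJ : forall i, isometric (J i).
Hypothesis f1 : VL1 (lebesgue_borel R k.+1) f.
Hypothesis f2 : L1 (lebesgue_borel R k.+1) (fun x => sqnorm (f x)).

Let m1 := @lebesgue_measure R.
Let m2 := lebesgue_borel R k.
Let J' i := J (lift ord0 i).
Let F (z : T * k.-tuple R) := f (tuple_cons z).

Let F1 : VL1 (m1 \x m2)%E F. Proof. by move=> S; exact: L1_tuple_cons (f1 S). Qed.
Let F2 : L1 (m1 \x m2)%E (fun z => sqnorm (F z)). Proof. exact: L1_tuple_cons f2. Qed.
Let mF : Vmeas F. Proof. exact: VL1_meas F1. Qed.

Let mFx x : Vmeas (fun x' => F (x, x')).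
Proof. by move=> S; exact: measurableT_comp (mF S) (measurable_pair1 x). Qed.

(** The partial transform, in all variables but the first. *)
Let g (z : T * k.-tuple R) : V := phase_transform J' (fun x' => F (z.1, x')) z.2.

Let mg : Vmeas g.
Proof.
apply: (Vmeas_Vint m2 (f := fun u : (T * k.-tuple R) * k.-tuple R =>
  phase_op J' u.2 u.1.2 (F (u.1.1, u.2)))).
apply: Vmeas_phase_op => //; first exact: measurableT_comp.
move=> S; apply: (measurableT_comp (mF S)).
by apply: measurable_fun_pair => //; exact: measurableT_comp.
Qed.

Let g1 y' : VL1 m1 (fun x => g (x, y')).
Proof.
move=> S; under [X in L1 m1 X]eq_fun do rewrite /g coef_Vint /=.
apply: (L1_Rintegral (m1 := m1) (m2 := m2)
  (f := fun z => coef (phase_op J' z.2 y' (F z)) S)).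
by apply: (VL1_phase_op (f := F)) => // i; exact: iJ.
Qed.

Let ae_F1 : {ae m1, forall x, VL1 m2 (fun x' => F (x, x'))}.
Proof.
have := ae_L1_section (VL1_l1norm F1); apply: filterS => x /= Fx.
by apply: VL1_le Fx _ => //.
Qed.

(** For almost every [x] the section of [F] at [x] is integrable, and then the
    rotor in the first variable can be pulled out of the integral over the other
    variables. *)
Let transform_cons y y' : phase_transform J f (tuple_cons (y, y')) =
  Vint m1 (fun x : T => rotor (J ord0) (x * y) (g (x, y'))).
Proof.
apply/cliffP => S; rewrite !coef_Vint.
rewrite Rintegral_tuple_cons; last exact: (VL1_phase_op (f := f)).
under eq_Rintegral do rewrite phase_op_cons/=.
pose H z := rotor (J ord0) (z.1 * y) (phase_op J' z.2 y' (F z)).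
have mH : Vmeas H.
  apply: Vmeas_rotor; last by apply: Vmeas_phase_op.
  by apply: measurable_funM.
have H1 : VL1 (m1 \x m2)%E H.
  apply: (@VL1_le _ _ _ _ _ _ (fun z => (2 * #|{set 'I_m}|)%:R *
    l1norm (phase_op J' z.2 y' (F z)))) => //.
    by apply: L1Z; apply: VL1_l1norm; apply: (VL1_phase_op (f := F)) => // i; exact: iJ.
  by move=> z; exact: l1norm_rotor.
rewrite (Rintegral_prod (m1 := m1) (m2 := m2) (H1 S)).
apply: eq_Rintegral_ae.
- exact: measurable_Rintegral (mH S).
- apply: (Vmeas_rotor (f := fun x => g (x, y')) _ _ _) => //.
    by apply: measurable_funM.
  by move=> U; exact: measurableT_comp (mg U) (measurable_pair2 y').
apply: filterS ae_F1 => x /= Fx.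
transitivity (coef (Vint m2 (fun x' =>
  rotor (J ord0) (x * y) (phase_op J' x' y' (F (x, x'))))) S); first by rewrite coef_Vint.
rewrite Vint_rotor//; apply: (VL1_phase_op (f := fun x' => F (x, x'))) => // i.
exact: iJ.
Qed.

Hypothesis IH : forall h : k.-tuple R -> V, VL1 m2 h -> L1 m2 (fun x => sqnorm (h x)) ->
  (\int[m2]_y (sqnorm (phase_transform J' h y))%:E =
   ((2 * pi) ^+ k)%:E * \int[m2]_x (sqnorm (h x))%:E)%E.

Let msqnorm d (X : measurableType d) (h : X -> V) : Vmeas h ->
  measurable_fun setT (fun x => (sqnorm (h x))%:E).
Proof. by move=> mh; apply/measurable_EFinP; exact: measurable_sqnorm. Qed.

Let Esqnorm_ge0 (A : V) : (0 <= (sqnorm A)%:E)%E. Proof. by rewrite lee_fin sqnorm_ge0. Qed.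

Let pi2X_ge0 j : (0 <= ((2 * pi : R) ^+ j)%:E)%E.
Proof. by rewrite lee_fin exprn_ge0// mulr_ge0// pi_ge0. Qed.

(** Apply the induction hypothesis to almost every section of [F]. *)
Let partial_plancherel :
  (\int[m1]_x \int[m2]_y (sqnorm (g (x, y)))%:E =
   ((2 * pi) ^+ k)%:E * \int[m1 \x m2]_z (sqnorm (F z))%:E)%E.
Proof.
rewrite fubini_tonelli1//; last exact: msqnorm.
rewrite -ge0_integralZl//; last 2 first.
- by apply: measurable_fun_fubini_tonelli_F => //; exact: msqnorm.
- by move=> x _; apply: integral_ge0.
apply: ge0_ae_eq_integral => //.
- by apply: (measurable_fun_fubini_tonelli_F (fun z => (sqnorm (g z))%:E)) => //; exact: msqnorm.
- apply: emeasurable_funM => //.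
  by apply: measurable_fun_fubini_tonelli_F => //; exact: msqnorm.
- by move=> x _; apply: integral_ge0.
- by move=> x _; apply: mule_ge0 => //; apply: integral_ge0.
have : {ae m1, forall x, VL1 m2 (fun x' => F (x, x')) /\
    L1 m2 (fun x' => sqnorm (F (x, x')))}.
  by apply: filterI => //; exact: ae_L1_section F2.
by apply: filterS => x [Fx1 Fx2] _; exact: (IH Fx1 Fx2).
Qed.

Let ae_g2 : {ae m2, forall y', L1 m1 (fun x => sqnorm (g (x, y')))}.
Proof.
have g2 : L1 (m1 \x m2)%E (fun z => sqnorm (g z)).
  apply: L1_prod; first exact: measurable_sqnorm.
  under eq_integral do under eq_integral do rewrite ger0_norm ?sqnorm_ge0//.
  rewrite partial_plancherel lte_mul_pinfty//.
  by rewrite -EFin_Rintegral// ltry.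
exact: ae_integrable2 g2.
Qed.

Lemma phase_plancherel_step :
  (\int[lebesgue_borel R k.+1]_y (sqnorm (phase_transform J f y))%:E =
   ((2 * pi) ^+ k.+1)%:E * \int[lebesgue_borel R k.+1]_x (sqnorm (f x))%:E)%E.
Proof.
have mf := VL1_meas f1.
have mPf := msqnorm (Vmeas_phase_transform J mf).
rewrite ge0_integral_tuple_cons// fubini_tonelli2//; last first.
  exact: (measurableT_comp mPf (@measurable_tuple_cons R k)).
transitivity (\int[m2]_y' ((2 * pi)%:E * \int[m1]_x (sqnorm (g (x, y')))%:E))%E.
  apply: ge0_ae_eq_integral => //.
  - apply: (measurable_fun_fubini_tonelli_G
      (fun z => (sqnorm (phase_transform J f (tuple_cons z)))%:E)) => //.
    exact: (measurableT_comp mPf (@measurable_tuple_cons R k)).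
  - apply: emeasurable_funM => //.
    apply: (measurable_fun_fubini_tonelli_G (fun z => (sqnorm (g z))%:E)) => //.
    exact: msqnorm.
  - by move=> y _; apply: integral_ge0.
  - by move=> y _; apply: mule_ge0; [exact: (pi2X_ge0 1)|apply: integral_ge0].
  apply: filterS ae_g2 => y' /= gy' _.
  rewrite -(vector_plancherel (iJ ord0) (g1 y') gy').
  by apply: eq_integral => y _; rewrite transform_cons.
rewrite ge0_integralZl//; last 3 first.
- apply: (measurable_fun_fubini_tonelli_G (fun z => (sqnorm (g z))%:E)) => //.
  exact: msqnorm.
- by move=> y _; apply: integral_ge0.
- exact: (pi2X_ge0 1).
rewrite -(fubini_tonelli (fun z => (sqnorm (g z))%:E))//; last exact: msqnorm.
rewrite partial_plancherel muleA -EFinM -exprS.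
by rewrite [in RHS]ge0_integral_tuple_cons//; exact: msqnorm.
Qed.

End step.

(** Integrating out one variable at a time reduces to the line.  The partial
    transform in the remaining variables is integrable in the first one for
    every frequency, and square-integrable for almost every frequency by the
    induction hypothesis and Tonelli. *)
Theorem phase_plancherel k (J : 'I_k -> {linear V -> V}) (f : k.-tuple R -> V) :
  (forall i, isometric (J i)) -> VL1 (lebesgue_borel R k) f ->
  L1 (lebesgue_borel R k) (fun x => sqnorm (f x)) ->
  (\int[lebesgue_borel R k]_y (sqnorm (phase_transform J f y))%:E =
   ((2 * pi) ^+ k)%:E * \int[lebesgue_borel R k]_x (sqnorm (f x))%:E)%E.
Proof.
elim: k J f => [|k IHk] J f iJ f1 f2; last first.
  by apply: phase_plancherel_step => // h; apply: IHk => i; exact: iJ.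
have mf := VL1_meas f1.
rewrite expr0 mul1e; apply: eq_integral => y _; congr (sqnorm _)%:E.
apply/cliffP => S; rewrite coef_Vint /= /Rintegral integral_dirac//=.
  by rewrite indicE in_setT mul1r (tuple0 y) (tuple0 [tuple]).
by apply/measurable_EFinP; exact: mf.
Qed.

End iterated_plancherel.

(** * The exponential as the solution of a differential equation *)

Section clifford_exponential.
Context {R : realType} {m : nat}.
Local Notation V := (clifford R m).
Implicit Types (A B : V).

Lemma sqr_csign (S T : {set 'I_m}) : csign R S T ^+ 2 = 1.
Proof. by rewrite /csign -exprM mulnC exprM sqrrN expr1n expr1n. Qed.

Lemma norm_csign (S T : {set 'I_m}) : `|csign R S T| = 1.
Proof. by rewrite /csign normrX normrN1 expr1n. Qed.

Lemma coef_mul_le A B c S : (forall T, `|coef B T| <= c) ->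
  `|coef (A * B) S| <= l1norm A * c.
Proof.
move=> Bc; rewrite coefM (le_trans (ler_norm_sum _ _ _))// /l1norm mulr_suml.
by apply: ler_sum => T _; rewrite !normrM norm_csign mul1r ler_wpM2l.
Qed.

Definition Vderiv (E E' : R -> V) :=
  forall S (t : R), is_derive t 1 (fun t : R => coef (E t) S : R) (coef (E' t) S).

Lemma Vderiv_ext E E' F' : Vderiv E E' -> (forall t, E' t = F' t) -> Vderiv E F'.
Proof. by move=> EE' E'F' S t; rewrite -E'F'; exact: EE'. Qed.

Lemma Vderiv_cst A : Vderiv (fun=> A) (fun=> 0).
Proof. by move=> S t; rewrite coef0; exact: is_derive_cst. Qed.

Lemma VderivD E E' F F' : Vderiv E E' -> Vderiv F F' ->
  Vderiv (fun t => E t + F t) (fun t => E' t + F' t).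
Proof.
move=> EE' FF' S t; rewrite coefD.
under [fun _ => _]eq_fun do rewrite coefD.
exact: is_deriveD.
Qed.

Lemma Vderiv_scale (a a' : R -> R) A : (forall t : R, is_derive t 1 a (a' t)) ->
  Vderiv (fun t => a t *: A) (fun t => a' t *: A).
Proof.
move=> aa' S t; rewrite coefZ.
under [fun _ => _]eq_fun do rewrite coefZ.
apply: is_derive_eq; rewrite /GRing.scale/=; ring.
Qed.

Lemma is_derive_bigsum I (r : seq I) (h : I -> R -> R) (h' : I -> R) (t : R) :
  (forall i, is_derive t 1 (h i) (h' i)) ->
  is_derive t 1 (fun s => \sum_(i <- r) h i s) (\sum_(i <- r) h' i).
Proof.
move=> hh'; elim: r => [|i r IHr].
  rewrite big_nil (_ : (fun _ => _) = cst 0); first exact: is_derive_cst.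
  by apply/funext => s; rewrite big_nil.
rewrite big_cons (_ : (fun _ => _) = h i + fun s => \sum_(j <- r) h j s).
  exact: is_deriveD.
by apply/funext => s; rewrite big_cons.
Qed.

Lemma VderivM E E' F F' : Vderiv E E' -> Vderiv F F' ->
  Vderiv (fun t => E t * F t) (fun t => E' t * F t + E t * F' t).
Proof.
move=> EE' FF' S t; rewrite coefD !coefM -big_split/=.
under [fun _ => _]eq_fun do rewrite coefM.
apply: is_derive_bigsum => T.
have EE'T := EE' T t; have FF'T := FF' (symdiff T S) t.
apply: is_derive_eq; by rewrite /GRing.scale/=; ring.
Qed.

Lemma is_derive_divided_power (N : nat) (t : R) :
  is_derive t 1 (fun s : R => s ^+ N.+1 / N.+1`!%:R : R) (t ^+ N / N`!%:R).
Proof.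
have dX : is_derive t 1 (fun s : R => s ^+ N.+1 : R) (N.+1%:R * t ^+ N).
  by apply: DeriveDef; [exact: exprn_derivable|rewrite exp_derive /GRing.scale/= mulr1].
under [fun _ => _]eq_fun do rewrite mulrC.
apply: is_derive_eq; rewrite /GRing.scale/= factS natrM.
have f0 : N`!%:R != 0 :> R by rewrite pnatr_eq0 -lt0n fact_gt0.
have N0 : N.+1%:R != 0 :> R by [].
by rewrite invfM mulrACA mulVf// mul1r mulrC.
Qed.

(** By the mean value theorem, applied to the difference of the two sides. *)
Lemma le_of_derivative (h h' : R -> R) (c : R) (N : nat) :
  (forall t : R, is_derive t 1 h (h' t)) -> h 0 = 0 ->
  (forall t, 0 <= t <= 1 -> h' t <= c * (t ^+ N / N`!%:R)) ->
  forall t, 0 <= t <= 1 -> h t <= c * (t ^+ N.+1 / N.+1`!%:R).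
Proof.
move=> hh' h0 hc t /andP[t0 t1].
move: t0; rewrite le_eqVlt => /predU1P[<-|t0].
  by rewrite h0 expr0n mul0r mulr0.
pose u s := c * (s ^+ N.+1 / N.+1`!%:R) - h s.
pose u' s := c * (s ^+ N / N`!%:R) - h' s.
have uu' (s : R) : is_derive s 1 u (u' s).
  have dp := is_derive_divided_power N s.
  by apply: is_derive_eq; rewrite /GRing.scale/=.
have cu : {within `[0, t], continuous u}.
  by apply: derivable_within_continuous => s _; exact: ex_derive.
have [s + ut] := MVT t0 (fun s _ => uu' s) cu.
rewrite in_itv/= => /andP[s0 st].
rewrite {2}/u h0 expr0n mul0r mulr0 !subr0 in ut.
rewrite -subr_ge0 -/(u t) ut mulr_ge0// ?(ltW t0)// /u' subr_ge0 hc//.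
by rewrite (ltW s0) (le_trans (ltW st)).
Qed.

Definition exp_partial A (N : nat) (t : R) : V :=
  \sum_(k < N) (t ^+ k / k`!%:R) *: A ^+ k.

Lemma Vderiv_exp_partial A N :
  Vderiv (exp_partial A N.+1) (fun t => A * exp_partial A N t).
Proof.
elim: N => [|N IHN].
  rewrite (_ : exp_partial A 1 = fun=> 1).
    by apply: Vderiv_ext (Vderiv_cst 1) _ => t; rewrite /exp_partial big_ord0 mulr0.
  by apply/funext => t; rewrite /exp_partial big_ord1 !expr0 fact0 divr1 scale1r.
rewrite (_ : exp_partial A N.+2 = fun t => exp_partial A N.+1 t +
    (t ^+ N.+1 / N.+1`!%:R) *: A ^+ N.+1); last first.
  by apply/funext => t; rewrite {1}/exp_partial big_ord_recr.
apply: (@Vderiv_ext _ (fun t => A * exp_partial A N t + (t ^+ N / N`!%:R) *: A ^+ N.+1)).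
  apply: VderivD => //; apply: Vderiv_scale => t.
  exact: is_derive_divided_power.
by move=> t; rewrite [in RHS]/exp_partial big_ord_recr mulrDr/= -scalerAr -exprS.
Qed.

(** The derivative of the remainder of order [N + 1] is [A] times the remainder
    of order [N]; by induction, the coefficients of the latter are at most
    [M (|A| t)^N / N!], with the norm [l1norm] of [A]. *)
Lemma cexp_ode A (E : R -> V) (M : R) :
  Vderiv E (fun t => A * E t) -> E 0 = 1 -> (forall t S, `|coef (E t) S| <= M) ->
  cexp A = E 1.
Proof.
move=> EE' E0 EM.
have rem N t S : 0 <= t <= 1 ->
    `|coef (E t - exp_partial A N t) S| <= M * l1norm A ^+ N * (t ^+ N / N`!%:R).
  elim: N t S => [|N IHN] t S t01.
    by rewrite /exp_partial big_ord0 subr0 !expr0 fact0 divr1 !mulr1.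
  pose g s := E s - exp_partial A N.+1 s.
  have gg' : Vderiv g (fun s => A * (E s - exp_partial A N s)).
    move=> U s; rewrite mulrBr coefD coefN.
    under [fun _ => _]eq_fun do rewrite coefD coefN.
    by apply: is_deriveB; [exact: EE'|exact: Vderiv_exp_partial].
  have g0 : g 0 = 0.
    rewrite /g E0 /exp_partial big_ord_recl/= expr0 fact0 divr1 scale1r.
    by rewrite big1 ?addr0 ?subrr// => i _; rewrite /bump/= expr0n mul0r scale0r.
  have g'_le s U : 0 <= s <= 1 -> `|coef (A * (E s - exp_partial A N s)) U| <=
      M * l1norm A ^+ N.+1 * (s ^+ N / N`!%:R).
    move=> s01; apply: le_trans (coef_mul_le _ _ (fun T => IHN s T s01)) _.
    by rewrite exprS !mulrA (mulrC M).
  rewrite -/(g t) ler_norml; apply/andP; split; last first.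
    apply: (@le_of_derivative (fun s => coef (g s) S)
      (fun s => coef (A * (E s - exp_partial A N s)) S)) => //.
    - by rewrite g0 coef0.
    - by move=> s /(g'_le s S); exact/le_trans/ler_norm.
  rewrite lerNl.
  apply: (@le_of_derivative (fun s => - coef (g s) S)
    (fun s => - coef (A * (E s - exp_partial A N s)) S)) => //.
  - by move=> s; apply: is_deriveN; exact: gg'.
  - by rewrite g0 coef0 oppr0.
  - by move=> s /(g'_le s S); rewrite -normrN; exact/le_trans/ler_norm.
apply/cliffP => S; rewrite coefE.
apply/cvg_lim => //.
apply/cvgrPdist_le => e e0.
have : M * exp_coeff (l1norm A) N @[N --> \oo] --> 0.
  rewrite -[X in _ --> X](mulr0 M); apply: cvgM; first exact: cvg_cst.
  by apply: cvg_series_cvg_0; exact: is_cvg_series_exp_coeff.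
move=> /cvgr0Pnorm_le/(_ e e0); apply: filterS => N; apply: le_trans.
have -> : series (fun k => coef ((k`!)%:R^-1 *: A ^+ k) S) N = coef (exp_partial A N 1) S.
  rewrite /series/= big_mkord coef_sum; apply: eq_bigr => k _.
  by rewrite expr1n mul1r.
rewrite -coefN -coefD (le_trans (rem N 1 S _))//; first by rewrite ler01 lexx.
rewrite (le_trans _ (ler_norm _))// expr1n mul1r /exp_coeff/=.
by rewrite mulrA.
Qed.

End clifford_exponential.

(** * Multiplication by bivectors and the exponential of the phase *)

Section multiplications.
Context {R : realType} {m : nat}.
Local Notation V := (clifford R m).

Definition lmul (B A : V) : V := B * A.
Definition rmul (B A : V) : V := A * B.

Let lmul_linear B : linear (lmul B).
Proof. by move=> c A A'; rewrite /lmul mulrDr scalerAr. Qed.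

Let rmul_linear B : linear (rmul B).
Proof. by move=> c A A'; rewrite /rmul mulrDl scalerAl. Qed.

HB.instance Definition _ B :=
  GRing.isLinear.Build R V V *:%R (lmul B) (lmul_linear B).
HB.instance Definition _ B :=
  GRing.isLinear.Build R V V *:%R (rmul B) (rmul_linear B).

Lemma coef_bladeM (S U : {set 'I_m}) (A : V) :
  coef (blade R S * A) U = csign R S (symdiff S U) * coef A (symdiff S U).
Proof.
rewrite coefM (bigD1 S)//= coef_blade eqxx mul1r big1 ?addr0// => T TS.
by rewrite coef_blade (negPf TS) mul0r mulr0.
Qed.

Lemma coef_Mblade (S U : {set 'I_m}) (A : V) :
  coef (A * blade R S) U = csign R (symdiff S U) S * coef A (symdiff S U).
Proof.
rewrite coefM (bigD1 (symdiff S U))//= coef_blade.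
have -> : symdiff (symdiff S U) U = S.
  by rewrite symdiffC (symdiffC S) symdiffK.
rewrite eqxx mulr1 big1 ?addr0// => T TSU; rewrite coef_blade.
have : symdiff T U != S.
  apply: contra TSU => /eqP <-; apply/eqP.
  by rewrite (symdiffC T) (symdiffC _ U) symdiffK.
by move=> /negPf ->; rewrite !mulr0.
Qed.

Lemma sqnorm_bladeM (S : {set 'I_m}) (A : V) : sqnorm (blade R S * A) = sqnorm A.
Proof.
rewrite /sqnorm [RHS](reindex_inj (can_inj (symdiffK S)))/=.
by apply: eq_bigr => U _; rewrite coef_bladeM exprMn sqr_csign mul1r.
Qed.

Lemma sqnorm_Mblade (S : {set 'I_m}) (A : V) : sqnorm (A * blade R S) = sqnorm A.
Proof.
rewrite /sqnorm [RHS](reindex_inj (can_inj (symdiffK S)))/=.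
by apply: eq_bigr => U _; rewrite coef_Mblade exprMn sqr_csign mul1r.
Qed.

End multiplications.

Section commuting_imaginary_units.
Context {R : realType} {m : nat} (k : nat).
Local Notation V := (clifford R m).
Variable B : 'I_k -> V.
Hypothesis BB : forall i, B i * B i = -1.
Hypothesis Bcomm : forall i j, B i * B j = B j * B i.

Definition phase_factor (i : 'I_k) (t : R) : V := cos t *: 1 - sin t *: B i.

Let comm_factor i j t : GRing.comm (B j) (phase_factor i t).
Proof.
by rewrite /GRing.comm /phase_factor mulrBr mulrBl -!scalerAr -!scalerAl mulr1 mul1r Bcomm.
Qed.

Lemma phase_factorC i j s t :
  phase_factor i s * phase_factor j t = phase_factor j t * phase_factor i s.
Proof.
move: (phase_factor j t) (comm_factor j i t) => P BP.
by rewrite /phase_factor mulrBl mulrBr -!scalerAl -!scalerAr mulr1 mul1r BP.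
Qed.

Let Vderiv_factor i (c : R) :
  Vderiv (fun t => phase_factor i (t * c)) (fun t => (- (c *: B i)) * phase_factor i (t * c)).
Proof.
apply: (@Vderiv_ext _ _ _ (fun t => (- (sin (t * c) * c)) *: 1 + (- (cos (t * c) * c)) *: B i)).
  rewrite (_ : (fun t => _) =
    fun t => cos (t * c) *: 1 + (- sin (t * c)) *: B i); last first.
    by apply/funext => t; rewrite /phase_factor scaleNr.
  apply: VderivD; apply: Vderiv_scale => t.
    by apply: is_derive_eq; rewrite /GRing.scale/=; ring.
  by apply: is_derive_eq; rewrite /GRing.scale/=; ring.
move=> t; rewrite /phase_factor mulrBr !mulNr -!scalerAl -!scalerAr mulr1 BB.
by rewrite !scalerN !scalerA opprK addrC !scaleNr (mulrC c) (mulrC c).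
Qed.

Section exponential.
Variable c : 'I_k -> R.

Let E (r : seq 'I_k) (t : R) : V := \prod_(i <- r) phase_factor i (t * c i).
Let A (r : seq 'I_k) : V := - \sum_(i <- r) c i *: B i.

Let Vderiv_E r : Vderiv (E r) (fun t => A r * E r t).
Proof.
elim: r => [|i r IHr].
  rewrite (_ : E [::] = fun=> 1).
    by apply: Vderiv_ext (Vderiv_cst 1) _ => t; rewrite /A big_nil oppr0 mul0r.
  by apply/funext => t; rewrite /E big_nil.
rewrite (_ : E (i :: r) = fun t => phase_factor i (t * c i) * E r t); last first.
  by apply/funext => t; rewrite /E big_cons.
apply: Vderiv_ext (VderivM (Vderiv_factor i (c i)) IHr) _ => t.
rewrite !mulrA -mulrDl; congr (_ * _).
rewrite /A big_cons opprD [RHS]mulrDl; congr (_ + _).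
rewrite mulrN mulNr; congr (- _).
rewrite mulr_sumr mulr_suml; apply: eq_bigr => j _.
by rewrite -scalerAr -scalerAl comm_factor.
Qed.

Let E_bounded r : exists M, forall t S, `|coef (E r t) S| <= M.
Proof.
elim: r => [|i r [M EM]].
  exists (l1norm (1 : V)) => t S; rewrite /E big_nil; exact: coef_le_l1norm.
exists (M + l1norm (B i) * M) => t S; rewrite /E big_cons -/(E r t).
rewrite /phase_factor mulrBl -!scalerAl mul1r coefD coefN !coefZ.
rewrite (le_trans (ler_normB _ _))// !normrM lerD//.
  by rewrite (le_trans _ (EM t S))// ler_piMl// norm_cos_le1.
by rewrite (le_trans _ (coef_mul_le (B i) S (EM t)))// ler_piMl// norm_sin_le1.
Qed.

(** Scale the coefficients [c i] by a time [t]: each factor then has derivative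
    [- c i B i] times itself, and by commutation so does the product, with the
    sum of the [- c i B i]. *)
Lemma cexp_commuting :
  cexp (- \sum_i c i *: B i) = \prod_i phase_factor i (c i).
Proof.
have [M EM] := E_bounded (index_enum 'I_k).
rewrite (cexp_ode (Vderiv_E (index_enum 'I_k)) _ EM).
  by apply: eq_bigr => i _; rewrite mul1r.
by rewrite /E big1// => i _; rewrite /phase_factor mul0r cos0 sin0 scale0r subr0 scale1r.
Qed.

End exponential.
End commuting_imaginary_units.

Section phase_op_mul.
Context {R : realType} {m : nat}.
Local Notation V := (clifford R m).

Let tnth_behead_lift k (x : k.+1.-tuple R) i :
  tnth [tuple of behead x] i = tnth x (lift ord0 i).
Proof. by rewrite [in RHS](tuple_eta x) tnthS. Qed.

Lemma phase_op_lmul k (B : 'I_k -> V) x y A :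
  phase_op (fun i => lmul (B i)) x y A =
  (\prod_i phase_factor B i (tnth x i * tnth y i)) * A.
Proof.
elim: k B x y => [|k IHk] B x y; first by rewrite big_ord0 mul1r.
rewrite big_ord_recl /= (IHk (fun i => B (lift ord0 i))).
rewrite (eq_bigr (fun i => phase_factor B (lift ord0 i)
  (tnth x (lift ord0 i) * tnth y (lift ord0 i)))); last first.
  by move=> i _; rewrite !tnth_behead_lift.
move: (\prod_(i < k) _) => P; rewrite /rotor /= /lmul -mulrA.
by rewrite /phase_factor mulrBl -!scalerAl mul1r.
Qed.

(** The rotor of the first coordinate acts last, so its factor ends up on the
    right of the product and has to be moved to the front. *)
Lemma phase_op_rmul k (B : 'I_k -> V) x y A :
  (forall i j, B i * B j = B j * B i) ->
  phase_op (fun i => rmul (B i)) x y A =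
  A * \prod_i phase_factor B i (tnth x i * tnth y i).
Proof.
elim: k B x y => [|k IHk] B x y BC; first by rewrite big_ord0 mulr1.
rewrite big_ord_recl /= (IHk (fun i => B (lift ord0 i)))//.
rewrite (eq_bigr (fun i => phase_factor B (lift ord0 i)
  (tnth x (lift ord0 i) * tnth y (lift ord0 i)))); last first.
  by move=> i _; rewrite !tnth_behead_lift.
set P := \prod_(i < k) _.
have -> : phase_factor B ord0 (tnth x ord0 * tnth y ord0) * P =
    P * phase_factor B ord0 (tnth x ord0 * tnth y ord0).
  by apply/commr_prod => i _; exact: phase_factorC.
move: P => P; rewrite /rotor /= /rmul mulrA.
by rewrite /phase_factor mulrBr -!scalerAr mulr1.
Qed.

End phase_op_mul.

Section bivectors.
Context {R : realType} (n : nat).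
Local Notation B := (@bivector R n).

Let anti (i j : 'I_(n + n)) : i != j -> gen R i * gen R j = - (gen R j * gen R i).
Proof. exact: gen_anticomm. Qed.

Lemma bivector_sqr i : B i * B i = -1.
Proof.
rewrite /bivector /e_ /e'_ mulrA -(mulrA _ (gen R (rshift n i))) anti ?eq_rlshift//.
by rewrite mulrN mulNr mulrA gen_sqr mul1r gen_sqr.
Qed.

Lemma bivectorC i j : B i * B j = B j * B i.
Proof.
have [->//|ij] := eqVneq i j.
have commute_pair (a b c : clifford R (n + n)) :
    a * b = - (b * a) -> a * c = - (c * a) -> a * (b * c) = (b * c) * a.
  by move=> ab ac; rewrite mulrA ab mulNr -(mulrA b a c) ac mulrN opprK mulrA.
have lc : e_ R i * B j = B j * e_ R i.
  apply: commute_pair; apply: anti; last by rewrite eq_lrshift.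
  by rewrite (inj_eq (@lshift_inj _ _)).
have rc : e'_ R i * B j = B j * e'_ R i.
  apply: commute_pair; apply: anti; first by rewrite eq_rlshift.
  by rewrite (inj_eq (@rshift_inj _ _)).
by rewrite {1}/bivector -mulrA rc mulrA lc -mulrA.
Qed.

Lemma bivector_blade i : exists S, B i = csign R [set lshift n i] [set rshift n i] *: blade R S.
Proof. by rewrite /bivector /e_ /e'_ /gen bladeM; eexists. Qed.

(** A bivector is a blade up to sign, so multiplication by it permutes the
    coefficients up to sign. *)
Lemma isometric_lmul_bivector i : isometric (lmul (B i)).
Proof.
move=> A; have [S ->] := bivector_blade i.
by rewrite /= /lmul -scalerAl sqnormZ sqr_csign mul1r sqnorm_bladeM.
Qed.

Lemma isometric_rmul_bivector i : isometric (rmul (B i)).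
Proof.
move=> A; have [S ->] := bivector_blade i.
by rewrite /= /rmul -scalerAr sqnormZ sqr_csign mul1r sqnorm_Mblade.
Qed.

Lemma cexp_phase (x y : n.-tuple R) : cexp (- phase (x : Rn R n) (y : Rn R n)) =
  \prod_i phase_factor B i (tnth x i * tnth y i).
Proof. exact: (cexp_commuting bivector_sqr bivectorC). Qed.

End bivectors.

(** * Sets and functions measurable for a completed measure *)

Section completion.
Context d (T : measurableType d) (R : realType).
Variable mu : {sigma_finite_measure set T -> \bar R}.
Local Notation X := (caratheodory_type (mu_ext mu)).
Local Open Scope ereal_scope.

(** Intersect countable measurable covers of [A] that are optimal up to
    [1 / (n + 1)]. *)
Lemma outer_measurable_hull (A : set T) :
  exists F, [/\ measurable F, A `<=` F & mu F = mu_ext mu A].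
Proof.
have [Aoo|Afin] := eqVneq (mu_ext mu A) +oo.
  exists setT; split => //; apply/eqP; rewrite Aoo -leye_eq -Aoo.
  by rewrite -measurable_mu_extE//; exact: le_mu_ext.
have {}Afin : mu_ext mu A \is a fin_num.
  by rewrite ge0_fin_numE ?ltey// mu_ext_ge0.
have coverA n : exists C : (set T)^nat, measurable_cover A C /\
    \sum_(k <oo) mu (C k) < mu_ext mu A + (n.+1%:R^-1)%:E.
  have inv0 : (0 < n.+1%:R^-1 :> R)%R by [].
  by have [_ [C AC <-] ?] := lb_ereal_inf_adherent inv0 Afin; exists C.
have [C /all_and2[CA muC]] := choice coverA.
pose F := \bigcap_n \bigcup_k C n k.
have mF : measurable F.
  by apply: bigcapT_measurable => n; apply: bigcupT_measurable => k; exact: (CA n).1.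
have AF : A `<=` F by move=> x Ax n _; exact: (CA n).2.
exists F; split => //; rewrite -measurable_mu_extE//.
apply/eqP; rewrite eq_le; apply/andP; split; last exact: le_mu_ext.
apply/lee_addgt0Pr => _/posnumP[e].
near \oo => n.
apply: (@le_trans _ _ (mu_ext mu A + (n.+1%:R^-1)%:E)); last first.
  by rewrite leeD2l// lee_fin ltW//; near: n; exact: near_infty_natSinv_lt.
apply: le_trans (ltW (muC n)).
apply: (@le_trans _ _ (mu_ext mu (\bigcup_k C n k))).
  by apply: le_mu_ext; exact: bigcap_inf.
apply: le_trans (outer_measure_sigma_subadditive _ _) _.
apply: lee_nneseries => [k _ _|k _]; first exact: mu_ext_ge0.
by rewrite -[leRHS]measurable_mu_extE//; exact: (CA n).1.
Unshelve. all: by end_near. Qed.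

Let cara_finite (E : set X) : measurable E -> mu_ext mu E < +oo ->
  exists B N : set T, [/\ measurable B, mu.-negligible N & E `\` N = B `\` N].
Proof.
move=> mE Efin.
have [F [mF EF muF]] := outer_measurable_hull E.
have [N [mN FEN muN]] := outer_measurable_hull (F `\` E).
exists F, N; split => //.
  exists N; split => //; rewrite muN.
  have H : mu_ext mu E = mu_ext mu E + mu_ext mu (F `\` E).
    rewrite -{1}muF -measurable_mu_extE// setDE -{1}(setIidr EF).
    exact: mE F.
  have Ef : mu_ext mu E \is a fin_num by rewrite ge0_fin_numE// mu_ext_ge0.
  have : mu_ext mu E + mu_ext mu (F `\` E) <= mu_ext mu E + 0 by rewrite adde0 -H.
  rewrite leeD2lE// => FE0; apply/eqP; rewrite eq_le FE0; exact: mu_ext_ge0.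
apply/seteqP; split => x [] => [Ex Nx|Fx Nx]; split => //; first exact: EF.
by apply: contrapT => Ex; apply: Nx; exact: FEN.
Qed.

(** If [E] has finite outer measure, its hull exceeds it by a set of outer
    measure [0], and the hull of this excess is null; sigma-finiteness reduces to
    this case. *)
Lemma caratheodory_mod_null (E : set X) : measurable E ->
  exists B N : set T, [/\ measurable B, mu.-negligible N & E `\` N = B `\` N].
Proof.
move=> mE; have [S ST mS] := sigma_finiteT mu.
have ES n : exists BN : set T * set T, [/\ measurable BN.1, mu.-negligible BN.2 &
    (E `&` S n) `\` BN.2 = BN.1 `\` BN.2].
  have mSn : measurable (S n : set X).
    by apply: caratheodory_measurable_mu_ext; exact: (mS n).1.
  have mESn : measurable (E `&` S n : set X) by exact: measurableI.
  have ESfin : mu_ext mu (E `&` S n) < +oo.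
    apply: (@le_lt_trans _ _ (mu_ext mu (S n))).
      by apply: le_mu_ext; exact: subIsetr.
    by have [mSn' Sfin] := mS n; rewrite measurable_mu_extE.
  by have [B [N BN]] := cara_finite mESn ESfin; exists (B, N).
have [BN /all_and3[mB negN EBN]] := choice ES.
exists (\bigcup_n (BN n).1), (\bigcup_n (BN n).2); split.
- exact: bigcupT_measurable.
- exact: negligible_bigcup.
apply/seteqP; split => x.
  move=> [Ex Nx]; split => //.
  have [n _ Snx] : (\bigcup_n S n) x by rewrite -ST.
  exists n => //; have : ((E `&` S n) `\` (BN n).2) x.
    by split => //; apply: contra_not Nx; exists n.
  by rewrite EBN => -[].
move=> [[n _ Bx] Nx]; split => //.
have : ((BN n).1 `\` (BN n).2) x.
  by split => //; apply: contra_not Nx; exists n.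
by rewrite -EBN => -[[]].
Qed.

Let qseq (n : nat) : R := ratr (odflt 0%R (unpickle n : option rat)).

Let qseq_dense (a b : R) : (a < b)%R -> exists n, (a < qseq n < b)%R.
Proof.
move=> ab; have [q /=] := rat_in_itvoo ab.
rewrite in_itv/= => aqb.
by exists (pickle q); rewrite /qseq pickleK.
Qed.

(** Countably many superlevel sets, the rational ones, determine [f]: discard
    the union of their exceptional null sets.  The choice of a larger [M] allows
    several functions to share one null set. *)
Lemma measurable_fun_mod_null (f : X -> R) : measurable_fun setT f ->
  exists N : set T, [/\ measurable N, mu N = 0 &
    forall M : set T, measurable M -> N `<=` M ->
      measurable_fun setT (f \_ (~` M) : T -> R)].
Proof.
move=> mf.
have fq n : exists BN : set T * set T, [/\ measurable BN.1, mu.-negligible BN.2 &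
    [set x | (qseq n < f x)%R] `\` BN.2 = BN.1 `\` BN.2].
  have mfq : measurable ([set x | (qseq n < f x)%R] : set X).
    rewrite (_ : mkset _ = setT `&` f @^-1` `]qseq n, +oo[); first exact: mf.
    by rewrite setTI; apply/seteqP; split => x /=; rewrite in_itv/= andbT.
  by have [B [N BN]] := caratheodory_mod_null mfq; exists (B, N).
have [BN /all_and3[mB negN fBN]] := choice fq.
have [N [mN N0 subN]] := negligible_bigcup negN.
exists N; split => // M mM NM.
apply: (measurability _ (RGenOInfty.measurableE R)) => _ [_ [r ->] <-].
rewrite setTI.
pose W n : set T := if (r < qseq n)%R then
  ((BN n).1 `\` M) `|` (if (qseq n < 0)%R then M else set0) else set0.
rewrite (_ : _ @^-1` _ = \bigcup_n W n).
  apply: bigcupT_measurable => n; rewrite /W; case: ifP => // _.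
  by apply: measurableU; [exact: measurableD|case: ifP].
have BM n x : ~ M x -> (BN n).1 x <-> (qseq n < f x)%R.
  move=> Mx; have Nx : ~ (BN n).2 x.
    by move=> Nx; apply/Mx/NM/subN; exists n.
  split => [Bx|qf].
    have : ((BN n).1 `\` (BN n).2) x by [].
    by rewrite -fBN => -[].
  have : ([set x | (qseq n < f x)%R] `\` (BN n).2) x by [].
  by rewrite fBN => -[].
apply/seteqP; split => x /=; rewrite in_itv/= andbT patchE.
  case: ifPn => [|]; rewrite ?notin_setE ?in_setE/= => Mx rf.
    have [n /andP[rq qf]] := qseq_dense rf.
    by exists n => //; rewrite /W rq; left; split => //; apply/BM.
  have [n /andP[rq qf]] := qseq_dense rf.
  by exists n => //; rewrite /W rq qf; right; apply: contrapT.
move=> [n _]; rewrite /W; case: ifP => // rq [[/BM Bx Mx]|].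
  rewrite mem_set//; apply: lt_trans rq _; exact: Bx.
by case: ifP => // q0 Mx; rewrite memNset//; exact: lt_trans rq q0.
Qed.

Local Notation nu := (@completed_measure_extension _ T R mu).

Let idX (x : X) : T := x.

Let measurable_idX : measurable_fun setT idX.
Proof.
move=> _ A mA; rewrite setTI; exact: caratheodory_measurable_mu_ext mA.
Qed.

Lemma measurable_fun_completion d' (U : measurableType d') (f : T -> U) :
  measurable_fun setT f -> measurable_fun setT (f : X -> U).
Proof. by move=> mf; exact: (measurableT_comp mf measurable_idX). Qed.

Lemma ge0_integral_completion (f : T -> \bar R) : measurable_fun setT f ->
  (forall x, 0 <= f x) -> \int[nu]_x f x = \int[mu]_x f x.
Proof.
move=> mf f0.
transitivity (\int[pushforward nu idX]_x f x).
  by rewrite ge0_integral_pushforward.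
apply: eq_measure_integral => A mA _.
exact: measurable_mu_extE.
Qed.

Lemma L1_completion (f : T -> R) : measurable_fun setT f ->
  L1 nu (f : X -> R) <-> L1 mu f.
Proof.
move=> mf; have E := @ge0_integral_completion (fun x => `|(f x)%:E|).
split => /integrableP[mf' foo]; apply/integrableP; split.
- exact/measurable_EFinP.
- by rewrite -E//; exact/measurableT_comp/measurable_EFinP.
- exact/measurable_fun_completion/measurable_EFinP.
- by rewrite E//; exact/measurableT_comp/measurable_EFinP.
Qed.

Lemma Rintegral_completion (f : T -> R) : L1 mu f ->
  (\int[nu]_x f x)%R = (\int[mu]_x f x)%R.
Proof.
move=> f1; congr fine; rewrite integralE [in RHS]integralE.
have mf := measurable_int mu f1.
rewrite !ge0_integral_completion//.
- exact: measurable_funeneg.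
- exact: measurable_funepos.
Qed.

End completion.

(** * Plancherel's formula for the Clifford-Fourier transforms *)

Lemma L1_ae d (T : measurableType d) (R : realType)
    (mu : {measure set T -> \bar R}) (f g : T -> R) :
  measurable_fun setT g -> {ae mu, forall x, f x = g x} -> L1 mu f -> L1 mu g.
Proof.
move=> mg fg f1; have mf := L1_measurable f1.
case/integrableP : f1 => _ foo; apply/integrableP; split; first exact/measurable_EFinP.
rewrite (ge0_ae_eq_integral measurableT _ (f := fun x => `|(g x)%:E|%E)
  (g := fun x => `|(f x)%:E|%E))//.
- by apply: measurableT_comp => //; exact/measurable_EFinP.
- by apply: measurableT_comp => //; exact/measurable_EFinP.
- by apply: filterS fg => x /= -> _.
Qed.

Section scaled_measure.
Context d (T : measurableType d) (R : realType).
Variables (mu : {measure set T -> \bar R}) (c : {nonneg R}).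

Lemma Rintegral_mscale (f : T -> R) : L1 mu f ->
  \int[mscale c mu]_x f x = c%:num * \int[mu]_x f x.
Proof.
move=> f1; have mf : measurable_fun setT (EFin \o f) := measurable_int mu f1.
rewrite -[RHS]/(fine (c%:num * \int[mu]_x f x)%:E) EFinM EFin_Rintegral//.
congr fine; rewrite integralE [in RHS]integralE.
rewrite !ge0_integral_mscale//; last 2 first.
- exact: measurable_funeneg.
- exact: measurable_funepos.
rewrite [RHS]muleBr//.
by apply: fin_num_adde_defl; rewrite fin_numN; exact: integrable_neg_fin_num.
Qed.

End scaled_measure.

Section clifford_plancherel.
Context {R : realType} (n : nat).
Local Notation V := (clifford R (n + n)).
Local Notation mu := (lebesgue_borel R n).
Local Notation nu := (@lebesgue_Rn R n).
Local Notation c := (NngNum (powR_ge0 (2 * pi) (- (n%:R / 2)) :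
  0 <= (2 * pi : R) `^ (- (n%:R / 2)))).
Implicit Types f g : Rn R n -> V.

Let pi2_gt0 : 0 < 2 * pi :> R.
Proof. by rewrite mulr_gt0// pi_gt0. Qed.

Let c_gt0 : 0 < c%:num.
Proof. by rewrite /= powR_gt0. Qed.

Let c_sqr : c%:num ^+ 2 * (2 * pi) ^+ n = 1.
Proof.
rewrite /= -(powR_mulrn 2) ?powR_ge0// -powRrM mulNr divfK ?pnatr_eq0//.
by rewrite powR_invn ?(ltW pi2_gt0)// mulVf// expf_neq0// gt_eqF.
Qed.

Let Vmeas_cnorm f : Vmeas f -> measurable_fun setT (fun x => cnorm (f x)).
Proof.
move=> mf; apply: (measurableT_comp (f := @Num.sqrt R)).
  by apply: continuous_measurable_fun; exact: sqrt_continuous.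
exact: measurable_sqnorm.
Qed.

Let cnorm_sqr (A : V) : cnorm A ^+ 2 = sqnorm A.
Proof. by rewrite /cnorm sqr_sqrtr// sqnorm_ge0. Qed.

Let coef_le_cnorm (A : V) S : `|coef A S| <= cnorm A.
Proof.
rewrite -(@ler_pXn2r _ 2)// ?nnegrE ?sqrtr_ge0// cnorm_sqr.
by rewrite real_normK ?num_real// sqr_coef_le_sqnorm.
Qed.

Lemma normp2E f :
  normp 2%:E f = ((\int[@dm R n]_x (sqnorm (f x))%:E) `^ 2^-1)%E.
Proof.
rewrite /normp unlock; congr (_ `^ _)%E; apply: eq_integral => x _.
by rewrite /= ger0_norm ?sqrtr_ge0// powR_mulrn ?sqrtr_ge0// cnorm_sqr.
Qed.

Lemma ge0_integral_dm (h : Rn R n -> R) : measurable_fun setT h ->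
  (forall x, 0 <= h x) ->
  (\int[@dm R n]_x (h x)%:E = c%:num%:E * \int[nu]_x (h x)%:E)%E.
Proof.
move=> mh h0; rewrite ge0_integral_mscale//; first exact/measurable_EFinP.
by move=> x _; rewrite lee_fin.
Qed.

Let scale_lty (x : \bar R) : (0 <= x)%E -> (c%:num%:E * x < +oo)%E -> (x < +oo)%E.
Proof.
by case: x => [r| |]// _; rewrite ?ltry// gt0_muley// lte_fin.
Qed.

Let sqrt_lty (x : \bar R) : (x `^ 2^-1 < +oo)%E -> (x < +oo)%E.
Proof.
by case: x => [r| |]//; rewrite ?ltry// poweRyr// gt_eqF// invr_gt0.
Qed.

Lemma Lp1_VL1 f : Lp 1%E f -> VL1 nu f.
Proof.
move=> [mf]; rewrite /normp Lnorm1.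
under eq_integral do rewrite /= ger0_norm ?sqrtr_ge0//.
rewrite (ge0_integral_dm (Vmeas_cnorm mf)); last by move=> x; exact: sqrtr_ge0.
move=> foo S.
apply: (L1_le (mf S) (g := fun x => cnorm (f x))) => [x|]; first exact: coef_le_cnorm.
apply: ge0_L1; [exact: Vmeas_cnorm|by move=> x; exact: sqrtr_ge0|].
by apply: scale_lty foo; apply: integral_ge0 => x _; rewrite lee_fin sqrtr_ge0.
Qed.

Lemma Lp2_L1 f : Lp 2%:E f -> L1 nu (fun x => sqnorm (f x)).
Proof.
move=> [mf]; rewrite normp2E => foo.
have msf := measurable_sqnorm mf.
apply: ge0_L1 => //; first by move=> x; exact: sqnorm_ge0.
move: foo; rewrite ge0_integral_dm//; last by move=> x; exact: sqnorm_ge0.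
move=> foo; apply: scale_lty; first by apply: integral_ge0 => x _; rewrite lee_fin sqnorm_ge0.
exact: sqrt_lty.
Qed.

(** The coefficients of [f] have a common exceptional null set, off which they
    are Borel; [f] is replaced by [0] on it. *)
Lemma borel_representative f : Vmeas f ->
  exists2 f0 : n.-tuple R -> V, Vmeas f0 & {ae nu, forall x, f x = f0 x}.
Proof.
move=> mf; have fN S := measurable_fun_mod_null (mf S).
have [N /all_and3[mN N0 NM]] := choice fN.
pose M := \big[setU/set0]_S N S.
have mM : measurable M by apply: bigsetU_measurable => S _; exact: mN.
have M0 : mu M = 0%E.
  have : measurable M /\ mu M = 0%E.
    rewrite /M; elim/big_ind: _ => [|A B [mA A0] [mB B0]|S _].
    - by split=> //; exact: measure0.
    - by split; [exact: measurableU|rewrite null_set_setU].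
    - by split; [exact: mN|exact: N0].
  by case.
have NsubM S : N S `<=` M by rewrite /M (bigD1 S)//=; left.
exists (fun x => mkcliff (fun S => ((fun x => coef (f x) S) \_ (~` M)) x)).
  by move=> S; under eq_fun do rewrite coefE; exact: NM.
exists M; split.
- exact: caratheodory_measurable_mu_ext.
- by rewrite -[RHS]M0; exact: measurable_mu_extE.
- move=> x /= fx; apply: contrapT => Mx; apply: fx.
  by apply/cliffP => S; rewrite coefE patchE mem_set.
Qed.

Section transform.
Variable J : 'I_n -> {linear V -> V}.
Hypothesis iJ : forall i, isometric (J i).
Variable f : Rn R n -> V.
Hypothesis f1 : VL1 nu f.
Hypothesis f2 : L1 nu (fun x => sqnorm (f x)).

Definition clifford_transform (y : Rn R n) : V :=
  cintegral (fun x => phase_op J x y (f x)).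

(** The normalizing constant of [dm] occurs three times on the left, once in the
    outer integral and squared in the transform, and once on the right; its
    square is the inverse of [(2 pi)^n]. *)
Lemma clifford_transform_plancherel :
  (\int[@dm R n]_y (sqnorm (clifford_transform y))%:E =
   \int[@dm R n]_x (sqnorm (f x))%:E)%E.
Proof.
have mf := VL1_meas f1.
have [f0 mf0 ff0] := borel_representative mf.
have mf0X : Vmeas (f0 : Rn R n -> V).
  by move=> S; exact: measurable_fun_completion (mf0 S).
have f01 : VL1 mu f0.
  move=> S; apply/(L1_completion mu (mf0 S)).
  by apply: L1_ae (f1 S) => //; apply: filterS ff0 => x ->.
have f02 : L1 mu (fun x => sqnorm (f0 x)).
  apply/(L1_completion mu (measurable_sqnorm mf0)).
  by apply: L1_ae f2; [exact: measurable_sqnorm|apply: filterS ff0 => x ->].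
have f01X : VL1 nu f0 by move=> S; apply/(L1_completion mu (mf0 S)).
have mid : measurable_fun setT (id : Rn R n -> n.-tuple R).
  by apply: (@measurable_fun_completion _ _ _ mu _ (n.-tuple R) id).
have E y : clifford_transform y = c%:num *: phase_transform J f0 y.
  apply/cliffP => S; rewrite coefZ coef_Vint coefE.
  rewrite Rintegral_mscale; last by apply: (VL1_phase_op (f := f)).
  congr (_ * _).
  rewrite -(Rintegral_completion (mu := mu)); last by apply: (VL1_phase_op (f := f0)).
  apply: eq_Rintegral_ae.
  - exact: (@Vmeas_phase_op _ _ _ (Rn R n) _ J id (cst y) f mid (measurable_cst _) mf S).
  - exact: (@Vmeas_phase_op _ _ _ (Rn R n) _ J id (cst y) f0 mid (measurable_cst _) mf0X S).
  - by apply: filterS ff0 => x ->.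
have EE y : sqnorm (clifford_transform y) = c%:num ^+ 2 * sqnorm (phase_transform J f0 y).
  by rewrite E sqnormZ.
have mPT := measurable_sqnorm (Vmeas_phase_transform J mf0).
rewrite ge0_integral_dm; last 2 first.
- under eq_fun do rewrite EE.
  have mcPT : measurable_fun setT
      (fun y : n.-tuple R => c%:num ^+ 2 * sqnorm (phase_transform J f0 y)).
    exact: measurable_funM (measurable_cst _) mPT.
  exact: (@measurable_fun_completion _ _ _ mu _ R _ mcPT).
- by move=> y; exact: sqnorm_ge0.
rewrite ge0_integral_dm; last 2 first.
- exact: measurable_sqnorm.
- by move=> x; exact: sqnorm_ge0.
congr (_ * _)%E.
under eq_integral do rewrite EE EFinM.
rewrite (ge0_integral_completion mu
  (f := fun y => ((c%:num ^+ 2)%:E * (sqnorm (phase_transform J f0 y))%:E)%E)); last 2 first.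
- by apply: emeasurable_funM => //; exact/measurable_EFinP.
- by move=> y; rewrite mule_ge0// lee_fin ?sqnorm_ge0// sqr_ge0.
rewrite ge0_integralZl//; last 2 first.
- exact/measurable_EFinP.
- by move=> y _; rewrite lee_fin sqnorm_ge0.
rewrite phase_plancherel// muleA -EFinM c_sqr mul1e.
rewrite -(ge0_integral_completion mu); last 2 first.
- by apply/measurable_EFinP; exact: measurable_sqnorm.
- by move=> x; rewrite lee_fin sqnorm_ge0.
apply: ge0_ae_eq_integral => //.
- by apply/measurable_EFinP; exact: measurable_sqnorm.
- by apply/measurable_EFinP; exact: measurable_sqnorm.
- by move=> x _; rewrite lee_fin sqnorm_ge0.
- by move=> x _; rewrite lee_fin sqnorm_ge0.
- by apply: filterS ff0 => x -> _.
Qed.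

End transform.
End clifford_plancherel.

Theorem proposition3p1 (R : realType) (n : nat)
    (f : Rn R n -> clifford R (n + n)) :
  Lp 1%E f -> Lp 2%:E f ->
  normp 2%:E f = normp 2%:E (fourier_left f) /\
  normp 2%:E (fourier_left f) = normp 2%:E (fourier_right f).
Proof.
move=> /Lp1_VL1 f1 /Lp2_L1 f2.
have left : fourier_left f = clifford_transform (fun i => lmul (bivector R i)) f.
  apply/funext => y; congr cintegral; apply/funext => x.
  by rewrite cexp_phase phase_op_lmul.
have right : fourier_right f = clifford_transform (fun i => rmul (bivector R i)) f.
  apply/funext => y; congr cintegral; apply/funext => x.
  by rewrite cexp_phase phase_op_rmul//; exact: bivectorC.
rewrite !normp2E left right !clifford_transform_plancherel//.
- exact: isometric_rmul_bivector.
- exact: isometric_lmul_bivector.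
Qed.
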